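(* For every $l\in\mathbb Z_{\ge0}\cup\{\infty\}$ and $(a_1,a_2,a_3,a_4)\in[0,\infty]^4$ with $l\le a_1\le a_2\le a_3\le a_4$, there exists a compact metric space $(X,d)$ such that \[ \dim_T X=l,\quad \dim_H(X,d)=a_1,\quad \dim_P(X,d)=a_2,\quad \overline{\dim}_B(X,d)=a_3,\quad \dim_A(X,d)=a_4. \]
   Context: $\dim_T X$ is the topological (covering) dimension of $X$. For a metric space $(X,d)$, $B(x,r)$ denotes the closed ball with center $x$ and radius $r$, and subsets carry the restricted metric. Hausdorff dimension: for $s\in[0,\infty)$ and $\delta>0$ let $\mathcal H^s_\delta(A)=\inf\{\sum_{i\ge1}\mathrm{diam}(A_i)^s : A\subset\bigcup_{i\ge 1}A_i,\ \mathrm{diam}(A_i)<\delta\}$ and $\mathcal H^s(A)=\sup_{\delta>0}\mathcal H^s_\delta(A)$; then $\dim_H(X,d)=\inf\{s\in[0,\infty):\mathcal H^s(X)=0\}$ (with $\inf\emptyset=\infty$). Packing dimension (radius-type): for $A\subset X$, $s\in[0,\infty)$ and $\delta>0$, let $\widetilde{\mathcal P}^s_\delta(A)$ be the supremum of $\sum_i r_i^s$ over all finite or countable sequences $\{r_i\}$ in $(0,\delta)$ for which there are points $x_i\in A$ such that the closed balls $B(x_i,r_i)$ are pairwise disjoint. Put $\widetilde{\mathcal P}^s_0(A)=\inf_{\delta>0}\widetilde{\mathcal P}^s_\delta(A)$ and $\mathcal P^s(A)=\inf\{\sum_{i\ge1}\widetilde{\mathcal P}^s_0(S_i): A\subset\bigcup_{i\ge1}S_i\}$;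 then $\dim_P(X,d)=\inf\{s\in[0,\infty):\mathcal P^s(X)=0\}$ (with $\inf\emptyset=\infty$). Upper box dimension: $N_d(X,r)$ is the least cardinality of a subset $A\subset X$ with $X=\bigcup_{a\in A}B(a,r)$, and $\overline{\dim}_B(X,d)=\limsup_{r\to0}\frac{\log N_d(X,r)}{-\log r}$. Assouad dimension: $\dim_A(X,d)$ is the infimum of all $\lambda\in(0,\infty)$ for which there is $C\in(0,\infty)$ such that $N_d(B(x,R),r)\le C(R/r)^\lambda$ for all $x\in X$ and all $R>r>0$; it is $\infty$ if no such $\lambda$ exists. *)

(* Defs.v *)
From mathcomp Require Import all_boot all_order all_algebra.
From mathcomp Require Import all_classical all_reals all_analysis.

Set Implicit Arguments.
Unset Strict Implicit.
Unset Printing Implicit Defensive.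

Import Order.TTheory GRing.Theory Num.Theory.
Import numFieldNormedType.Exports.

Local Open Scope classical_set_scope.
Local Open Scope ring_scope.
Local Open Scope card_scope.
Local Open Scope ereal_scope.

(* Not the library's [closed_ball], which is the closure of the open ball and
   may be smaller in a general metric space. *)
Definition cball (R : realType) (X : metricType R) (x : X) (r : R) : set X :=
  [set y | (mdist x y <= r)%R].

(* Every finite open cover of X has a finite open refinement such that each
   point of X lies in at most k of its members. *)
Definition covering_mult_le (X : topologicalType) (k : nat) : Prop :=
  forall C : set (set X), finite_set C -> C `<=` open ->
    \bigcup_(U in C) U = setT ->
  exists D : set (set X), [/\ finite_set D, D `<=` open,
    \bigcup_(V in D) V = setT,
    (forall V, D V -> exists2 U, C U & V `<=` U) &
    (forall x, [set V | D V /\ V x] #<= `I_k)].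

(* Multiplicity at most k means dimension at most k - 1; the empty space has
   dimension -1. *)
Definition dim_T (R : realType) (X : topologicalType) : \bar R :=
  ereal_inf [set (k%:R - 1)%R%:E | k in [set k | covering_mult_le X k]].

Section MetricDimensions.
Context {R : realType} (X : metricType R).
Implicit Types (A S : set X) (s r delta lambda : R).

(* The maximum with 0 gives the empty set diameter 0. *)
Definition diam A : \bar R :=
  maxe 0 (ereal_sup [set (mdist xy.1 xy.2)%:E | xy in A `*` A]).

(* Here 0 `^ 0 = 1, whereas empty sets contribute 0 even for s = 0, so that
   the measure is the counting measure for s = 0. *)
Definition hausdorff_pre s delta A : \bar R :=
  ereal_inf [set \sum_(i <oo | F i != set0) diam (F i) `^ s
    | F in [set F : (set X)^nat |
        A `<=` \bigcup_i F i /\ forall i, diam (F i) < delta%:E]].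

Definition hausdorff_measure s A : \bar R :=
  ereal_sup [set hausdorff_pre s delta A | delta in [set delta | (0 < delta)%R]].

Definition dim_H : \bar R :=
  ereal_inf [set s%:E | s in
    [set s | (0 <= s)%R /\ hausdorff_measure s [set: X] = 0]].

(* A packing is recorded as the set of its pairs (center, radius): as a closed
   ball of positive radius meets itself, a family of pairwise disjoint balls
   never repeats a pair. *)
Definition is_packing delta A (Q : set (X * R)) : Prop :=
  [/\ countable Q,
      forall p, Q p -> A p.1 /\ (0 < p.2 < delta)%R &
      trivIset Q (fun p => cball p.1 p.2)].

Definition packing_pre s delta A : \bar R :=
  ereal_sup [set \esum_(p in Q) (p.2 `^ s)%R%:E | Q in is_packing delta A].

Definition packing_pre0 s A : \bar R :=
  ereal_inf [set packing_pre s delta A | delta in [set delta | (0 < delta)%R]].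

Definition packing_measure s A : \bar R :=
  ereal_inf [set \sum_(i <oo) packing_pre0 s (S i)
    | S in [set S : (set X)^nat | A `<=` \bigcup_i S i]].

Definition dim_P : \bar R :=
  ereal_inf [set s%:E | s in
    [set s | (0 <= s)%R /\ packing_measure s [set: X] = 0]].

(* The centers are required to lie in S, which carries the restricted metric;
   the value is +oo when no finite set of centers suffices. *)
Definition covering_number S r : \bar R :=
  ereal_inf [set n%:R%:E | n in [set n : nat | exists A,
    [/\ A `<=` S, A #= `I_n & S `<=` \bigcup_(a in A) cball a r]]].

Definition dim_uB : \bar R :=
  limf_esup (fun r => lne (covering_number [set: X] r) / (- ln r)%R%:E) 0%R^'+.

Definition dim_A : \bar R :=
  ereal_inf [set lambda%:E | lambda in [set lambda | (0 < lambda)%R /\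
    exists2 C : R, (0 < C)%R & forall (x : X) (r r' : R), (0 < r < r')%R ->
      covering_number (cball x r') r <= (C * (r' / r) `^ lambda)%R%:E]].

End MetricDimensions.

(* Main.v *)
Require Import Defs.
From HB Require Import structures.
From mathcomp Require Import all_boot all_order all_algebra all_fingroup.
From mathcomp Require Import zify ring lra.
From mathcomp Require Import all_classical all_reals all_analysis.

(* The space is a disjoint union, at mutual distance 1, of three compact pieces;
   each dimension is then the largest of those of the pieces.
   - A cube [0,1]^l (the Hilbert cube for l = oo) has covering dimension l, and
     its Assouad dimension, the largest of the other four, is l.
   - A Cantor set {0,1}^N with distance 2^-(e j) at first difference j is
     homogeneous, so only the growth of e matters: the Hausdorff dimension is
     liminf j / e j, the packing dimension limsup j / e j, and the Assouad
     dimension the asymptotic slope of j against e.  Long jumps of e separate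
     the first from the other two.
   - The sequences x in such a Cantor set whose first nonzero coordinate j
     forces x i = 0 for i >= (j + 1)^2 form a countable compact set, of
     Hausdorff and packing dimension 0, with the same box and Assouad dimensions
     as the whole Cantor set; here the slope of e is changed on short blocks, so
     that the Assouad dimension exceeds the box dimension. *)

Set Implicit Arguments.
Unset Strict Implicit.
Unset Printing Implicit Defensive.
Import Order.TTheory GRing.Theory Num.Theory.
Import numFieldNormedType.Exports.

Local Open Scope classical_set_scope.
Local Open Scope ring_scope.
Local Open Scope card_scope.

(** * Sperner's lemma on a cubical grid *)

(** The pieces are dictated by an obstacle. A Cantor set with the same branching everywhere cannot
    separate packing from upper box dimension: by Baire, one member of any countable cover is dense
    in a cylinder, and separated points do not distinguish a set from a dense subset. So the two
    largest dimensions come from a countable set, invisible to the two before them; its points other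
    than the zero word are isolated, and its large counts are found near that word. The dimensions
    of the pieces are not computed separately: every bound is proved on the union. For the metric
    dimensions, upper bounds count classes of small diameter, lower bounds count separated points or
    use a mass distribution, and all of them reduce to inequalities between [j] and [e j]. Each is
    stated for real exponents on one side of the target, so infinite targets need no limits. The
    lower bound on covering dimension is the one topological obstruction. It rests on Sperner's
    lemma, proved with determinants modulo 2: column expansion replaces the counting of facets. *)

Lemma addF2 (x : 'F_2) : x + x = 0.
Proof. by case: x => -[|[|//]] i; apply/val_inj. Qed.

Lemma signF2 k : (-1) ^+ k = 1 :> 'F_2.
Proof. by rewrite (_ : -1 = 1 :> 'F_2) ?expr1n//; apply/val_inj. Qed.

(* The t-th simplex of Kuhn's triangulation of the cube at z; t is the inverse
   of the usual permutation: step t j increases coordinate j. *)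
Definition kuhn n m (z : {ffun 'I_n -> 'I_m}) (t : 'S_n) (k i : nat) : nat :=
  if insub i is Some j then (z j + (t j < k))%N else 0%N.

Lemma kuhnE n m (z : {ffun 'I_n -> 'I_m}) (t : 'S_n) k (j : 'I_n) :
  kuhn z t k j = (z j + (t j < k))%N.
Proof. by rewrite /kuhn valK. Qed.

Lemma kuhn_out n m (z : {ffun 'I_n -> 'I_m}) (t : 'S_n) k i :
  (n <= i)%N -> kuhn z t k i = 0%N.
Proof. by move=> ni; rewrite /kuhn insubN// -leqNgt. Qed.

Lemma eq_kuhn n m (z z' : {ffun 'I_n -> 'I_m}) (t t' : 'S_n) k k' :
  (forall j, z j + (t j < k) = z' j + (t' j < k'))%N ->
  kuhn z t k = kuhn z' t' k'.
Proof.
move=> h; apply/funext => i; case: (ltnP i n) => ni; last by rewrite !kuhn_out.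
by rewrite -[i]/(val (Ordinal ni)) !kuhnE h.
Qed.

Section Sperner.
Variable lab : (nat -> nat) -> nat.

(* Nonzero only if the n + 1 labels are distinct.  The last column is the sum of
   all the indicator columns, so that Laplace expansion along it yields facets. *)
Definition volume n (v : nat -> nat -> nat) : 'F_2 :=
  \det (\matrix_(k < n.+1, j < n.+1)
    (if j == n :> nat then 1 else (lab (v k) == j)%:R)).

Definition facet n (v : nat -> nat -> nat) : 'F_2 :=
  \det (\matrix_(k < n, j < n) (lab (v k) == j :> nat)%:R).

Lemma volume_facets n v : volume n v = \sum_(k < n.+1) facet n (v \o bump k).
Proof.
rewrite /volume (expand_det_col _ ord_max); apply: eq_bigr => k _.
rewrite mxE eqxx mul1r /cofactor signF2 mul1r; congr (\det _).
apply/matrixP => i j; rewrite !mxE /= /bump leqNgt ltn_ord add0n.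
by rewrite (ltn_eqF (ltn_ord j)).
Qed.

Lemma eq_facet n v v' : (forall k, (k < n)%N -> v k = v' k) ->
  facet n v = facet n v'.
Proof.
move=> vv'; congr (\det _); apply/matrixP => k j; rewrite !mxE.
by rewrite (vv' k).
Qed.

Lemma facet0 n v (j : 'I_n) : (forall k, (k < n)%N -> lab (v k) != j) ->
  facet n v = 0.
Proof.
move=> vj; rewrite /facet (expand_det_col _ j) big1// => k _.
by rewrite mxE (negbTE (vj _ _)) ?mul0r.
Qed.

(** Each row of the facet matrix holds a single 1. Adding all columns to the last one, which is
    multiplication by the unitriangular [U], therefore turns that column into ones. *)
Lemma facet_volume n v : (forall k, (k <= n)%N -> (lab (v k) <= n)%N) ->
  facet n.+1 v = volume n v.
Proof.
move=> vn; pose U : 'M['F_2]_n.+1 :=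
  \matrix_(i, j) ((i == j) || (j == n :> nat))%:R.
have detU : \det U^T = 1.
  rewrite det_trig; last first.
    apply/is_trig_mxP => i j ij; rewrite !mxE -val_eqE /=.
    by have := ltn_ord j; case: eqP => [|_]; case: eqP => //; lia.
  by rewrite big1// => i _; rewrite !mxE eqxx.
rewrite /facet -[LHS]mulr1 -[X in _ * X]detU det_tr -det_mulmx /volume; congr (\det _).
apply/matrixP => k j; rewrite !mxE.
have /= labk := vn k (ltn_ord k).
rewrite (bigD1 (Ordinal (labk : (lab (v k) < n.+1)%N))) //= big1.
  rewrite addr0 !mxE /= eqxx mulr1n mul1r -val_eqE /=.
  by case: (nat_of_ord j == n); rewrite ?orbT ?orbF.
by move=> i /negbTE; rewrite -val_eqE /= !mxE eq_sym => ->; rewrite mulr0n mul0r.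
Qed.

Lemma volume_neq0_inj n v (k k' : 'I_n.+1) :
  volume n v != 0 -> lab (v k) = lab (v k') -> k = k'.
Proof.
move=> v0 kk'; apply/eqP; apply: contraNT v0 => nkk'; apply/eqP.
rewrite /volume; apply: (determinant_alternate nkk') => j.
by rewrite !mxE kk'.
Qed.

(** Leaving out an interior vertex erases the order of the two steps around it, so a simplex and the
    one with these steps transposed share this facet. The parity of the permutation separates the
    two members of each pair. *)
Lemma sum_kuhn_swap n m (z : {ffun 'I_n -> 'I_m}) k : (0 < k < n)%N ->
  \sum_(t : 'S_n) facet n (kuhn z t \o bump k) = 0.
Proof.
move=> /andP[k0 kn]; have k1n : (k.-1 < n)%N by rewrite (leq_ltn_trans (leq_pred _)).
pose s : 'S_n := tperm (Ordinal k1n) (Ordinal kn).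
rewrite (bigID (fun t : 'S_n => odd_perm t)) /=.
rewrite [X in X + _](reindex_inj (mulIg s)) /=.
rewrite [X in X + _](eq_bigl (fun t : 'S_n => ~~ odd_perm t)); last first.
  move=> t /=; rewrite odd_permM odd_tperm -val_eqE /=.
  by rewrite (_ : (k.-1 != k)%N) ?addbT// -{2}(prednK k0) neq_ltn ltnSn.
rewrite -big_split /= big1// => t _.
rewrite -[RHS](addF2 (facet n (kuhn z t \o bump k))); congr (_ + _).
apply: eq_facet => k' k'n /=; apply: eq_kuhn => j; congr (_ + nat_of_bool _)%N.
rewrite permM; case: tpermP => [->|->|//] /=; rewrite /bump.
  by case: leqP => /= ?; rewrite ?add1n ?add0n; lia.
by case: leqP => /= ?; rewrite ?add1n ?add0n; lia.
Qed.

(** The rotation makes the last direction [a] the first one: the facet opposite the first vertex of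
    the rotated simplex at [z] is the facet opposite the last vertex of the simplex of [t] in the
    next cube in direction [a]. These cancel in pairs except on the two faces of the grid across
    [a], and on the far face no vertex is labelled [a]. *)
Lemma sum_kuhn_last n m (m0 : (0 < m)%N) (t : 'S_n.+1) (a := (t^-1)%g ord_max) :
  (forall (z : {ffun 'I_n.+1 -> 'I_m}) t' k,
    kuhn z t' k a = m -> lab (kuhn z t' k) != a) ->
  \sum_(z : {ffun 'I_n.+1 -> 'I_m})
     (facet n.+1 (kuhn z (t * perm (@ordS_inj n.+1))%g \o succn)
      + facet n.+1 (kuhn z t)) =
  \sum_(z : {ffun 'I_n.+1 -> 'I_m} | z a == 0 :> nat) facet n.+1 (kuhn z t).
Proof.
move=> labm; rewrite big_split /= (bigID (fun z : {ffun 'I_n.+1 -> 'I_m} => (z a).+1 == m)) /=.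
rewrite big1 ?add0r; last first.
  move=> z zam; apply: (@facet0 _ _ a) => k kn; apply: labm.
  by rewrite kuhnE permM permE /= permKV /= modnn addn1; apply/eqP.
pose shift (f : 'I_m -> 'I_m) (z : {ffun 'I_n.+1 -> 'I_m}) :=
  [ffun j => if j == a then f (z j) else z j].
have shiftK f g : cancel f g -> cancel (shift f) (shift g).
  by move=> fg z; apply/ffunP => j; rewrite !ffunE; case: eqP => //; rewrite fg.
rewrite [X in _ + X](bigID (fun z : {ffun 'I_n.+1 -> 'I_m} => z a == 0 :> nat)) /=.
rewrite [X in _ + (_ + X)](reindex (shift (@ordS m))) /=; last first.
  exists (shift (@ord_pred m)) => z _; apply: shiftK.
    exact: ordSK.
  exact: ord_predK.
rewrite addrCA [X in _ + X](_ : _ = 0) ?addr0//.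
rewrite [X in X + _](_ : _ = \sum_(z | (shift (@ordS m) z) a != 0 :> nat)
   facet n.+1 (kuhn (shift (@ordS m) z) t)); first exact: addF2.
apply: eq_big => [z|z zam].
  rewrite /shift ffunE eqxx /=; have := ltn_ord (z a); rewrite leq_eqVlt.
  case: eqP => [->|/eqP zam /= zm]; first by rewrite modnn.
  by rewrite modn_small.
apply: eq_facet => k kn /=; apply: eq_kuhn => j.
rewrite permM permE /= /shift ffunE.
have [->|ja] := eqVneq j a.
  rewrite permKV /= modnn modn_small; last first.
    by rewrite ltn_neqAle zam ltn_ord.
  have -> : (n < k)%N = false by rewrite ltnNge -ltnS kn.
  by rewrite addn0 addn1.
have tj : (t j < n)%N.
  rewrite ltn_neqAle -ltnS ltn_ord andbT; apply: contra ja => /eqP tj.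
  by apply/eqP; rewrite -(permK t j); congr ((t^-1)%g _); exact: val_inj.
by rewrite modn_small.
Qed.

(* Interior facets cancel in pairs modulo 2, and the labels kill the boundary
   facets except those at p n = 0, which are the volumes one dimension lower. *)
Lemma sum_volume n m : (0 < m)%N ->
  (forall p, (forall i, (i < n)%N -> (p i <= m)%N) ->
    (forall i, (n <= i)%N -> p i = 0%N) ->
    (lab p <= n)%N /\ forall i, (i < n)%N ->
      (p i = 0%N -> (lab p <= i)%N) /\ (p i = m -> lab p != i)) ->
  \sum_(t : 'S_n) \sum_(z : {ffun 'I_n -> 'I_m}) volume n (kuhn z t) = 1.
Proof.
move=> m0; elim: n => [|n IHn] labP.
  have f0 : 'I_0 -> 'I_m by case.
  rewrite (big_pred1 1%g) => [|t]; last first.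
    by apply/esym/eqP/permP => -[].
  rewrite (big_pred1 (finfun f0)) => [|z]; last first.
    by apply/esym/eqP/ffunP => -[].
  by rewrite /volume det_mx11 mxE.
have kuhn_le (z : {ffun 'I_n.+1 -> 'I_m}) (t : 'S_n.+1) k i :
    (i < n.+1)%N -> (kuhn z t k i <= m)%N.
  move=> ni; rewrite -[i]/(val (Ordinal ni)) kuhnE.
  by have := ltn_ord (z (Ordinal ni)); case: (_ < k)%N; lia.
have labK (z : {ffun 'I_n.+1 -> 'I_m}) t k := labP (kuhn z t k)
  (fun i => @kuhn_le z t k i) (fun i => @kuhn_out _ _ z t k i).
have labP' : forall p, (forall i, (i < n)%N -> (p i <= m)%N) ->
    (forall i, (n <= i)%N -> p i = 0%N) -> (lab p <= n)%N /\
    forall i, (i < n)%N -> (p i = 0%N -> (lab p <= i)%N) /\ (p i = m -> lab p != i).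
  move=> p pm p0.
  have pm' i : (i < n.+1)%N -> (p i <= m)%N.
    by case: (ltnP i n) => [/pm//|/p0->].
  have p0' i : (n.+1 <= i)%N -> p i = 0%N by move=> /ltnW/p0.
  have [_ pP] := labP p pm' p0'.
  have [/(_ (p0 _ (leqnn _))) ? _] := pP n (ltnSn n).
  by split => // i ni; apply: pP; rewrite ltnS ltnW.
rewrite -[RHS](IHn labP').
have split_faces v : volume n.+1 v = facet n.+1 (v \o succn) + facet n.+1 v +
    \sum_(i < n) facet n.+1 (v \o bump i.+1).
  rewrite volume_facets big_ord_recl big_ord_recr /= -addrA; congr (_ + _).
  rewrite addrC; congr (_ + _).
  by apply: eq_facet => k kn /=; rewrite /bump /= add1n ltnNge -ltnS kn.
under eq_bigr do under eq_bigr do rewrite split_faces.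
under eq_bigr do rewrite big_split.
rewrite big_split /= [X in _ + X]exchange_big [X in _ + X]big1 ?addr0 /=; last first.
  move=> z _; rewrite exchange_big big1// => i _; apply: sum_kuhn_swap.
  by rewrite /= ltnS.
under eq_bigr do rewrite big_split.
(* Reindexing the facets opposite the first vertex by the rotation brings the sum into the form of
   [sum_kuhn_last]. *)
rewrite big_split /= (reindex_inj (mulIg (perm (@ordS_inj n.+1)))) /= -big_split /=.
under eq_bigr => t _.
  rewrite -big_split sum_kuhn_last//; last first.
    move=> z t' k am; have [_ labi] := labK z t' k.
    by have [_ /(_ am)] := labi _ (ltn_ord ((t^-1)%g ord_max)).
  over.
rewrite /= (bigID (fun t : 'S_n.+1 => (t^-1)%g ord_max == ord_max)) /=.
rewrite [X in _ + X]big1 ?addr0; last first.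
  (* If the last direction is some [a < n], the near face has [p a = 0], so its labels are at most
     [a] and the label [n] is missing. *)
  move=> t tn; rewrite big1// => z /eqP za.
  pose a := (t^-1)%g ord_max; have an : (a < n)%N.
    by rewrite ltn_neqAle -ltnS ltn_ord andbT; exact: tn.
  apply: (@facet0 _ _ ord_max) => k kn /=.
  have [_ /(_ _ (ltn_ord a))[+ _]] := labK z t k.
  rewrite kuhnE permKV /= (ltnNge n) -ltnS kn za addn0 => /(_ erefl) laba.
  by rewrite ltn_eqF // (leq_ltn_trans laba).
(* What remains has last direction [n] and [z n = 0]: these facets are the simplices of the grid one
   dimension lower. *)
pose ext (z : {ffun 'I_n -> 'I_m}) : {ffun 'I_n.+1 -> 'I_m} :=
  [ffun i => if unlift ord_max i is Some j then z j else Ordinal m0].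
rewrite (reindex (lift_perm ord_max ord_max)) /=; last first.
  pose u (s : 'S_n.+1) k := odflt k (unlift (s ord_max) (s (lift ord_max k))).
  have uK (s : 'S_n.+1) k : lift (s ord_max) (u s k) = s (lift ord_max k).
    rewrite /u; have := neq_lift ord_max k.
    by rewrite -(can_eq (permK s)) => /unlift_some[] ? ? ->.
  have inj_u s : injective (u s).
    move=> k k' /(congr1 (lift (s ord_max))); rewrite !uK.
    by move/perm_inj/lift_inj.
  exists (fun s => perm (@inj_u s)) => [s _ | s].
    by apply/permP=> k'; rewrite permE /u lift_perm_lift lift_perm_id liftK.
  move=> /eqP sV; have sn : s ord_max = ord_max by rewrite -{1}sV permKV.
  apply/permP=> k.
  case: (unliftP ord_max k) => [k'|] ->; rewrite ?lift_perm_id //.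
  by rewrite lift_perm_lift permE -[X in lift X _]sn uK.
apply: eq_big => [t|t _]; first by rewrite lift_permV lift_perm_id eqxx.
rewrite lift_permV lift_perm_id (reindex ext) /=; last first.
  exists (fun z => [ffun j => z (lift ord_max j)]) => [z _|z /eqP zn].
    by apply/ffunP => j; rewrite !ffunE liftK.
  apply/ffunP => i; rewrite !ffunE.
  by case: unliftP => [j|] -> //; rewrite ?ffunE//; apply: val_inj.
have kuhn_ext z k : (k <= n)%N ->
    kuhn (ext z) (lift_perm ord_max ord_max t) k = kuhn z t k.
  move=> kn; apply/funext => i; case: (ltnP i n.+1) => ni; last first.
    by rewrite !kuhn_out// ltnW.
  rewrite -[i]/(val (Ordinal ni)) kuhnE /ext ffunE.
  case: unliftP => [j|] ->.
    have bumpE (j' : 'I_n) : bump n j' = j' by rewrite /bump leqNgt ltn_ord.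
    by rewrite lift_perm_lift /= !bumpE kuhnE.
  by rewrite lift_perm_id kuhn_out //= ltnNge kn.
apply: eq_big => [z|z _]; first by rewrite /ext ffunE unlift_none eqxx.
rewrite (@eq_facet _ _ (kuhn z t)); last by move=> k kn; exact: kuhn_ext.
apply: facet_volume => k kn.
apply: (proj1 (labP' (kuhn z t k) _ _)) => i ni; last by rewrite kuhn_out.
rewrite -[i]/(val (Ordinal ni)) kuhnE.
by have := ltn_ord (z (Ordinal ni)); case: (_ < k)%N; lia.
Qed.

Lemma grid_sperner n m : (0 < m)%N ->
  (forall p, (forall i, (i < n)%N -> (p i <= m)%N) ->
    (forall i, (n <= i)%N -> p i = 0%N) ->
    (lab p <= n)%N /\ forall i, (i < n)%N ->
      (p i = 0%N -> (lab p <= i)%N) /\ (p i = m -> lab p != i)) ->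
  exists v : nat -> nat -> nat,
    [/\ forall k i, (i < n)%N -> (v k i <= m)%N,
        forall k i, (v k i <= (v 0 i).+1)%N /\ (v 0 i <= v k i)%N &
        forall k k', (k <= n)%N -> (k' <= n)%N -> lab (v k) = lab (v k') -> k = k'].
Proof.
move=> m0 labP; have := sum_volume m0 labP.
have [[t [z vtz]] _|v0] := pselect (exists t (z : {ffun 'I_n -> 'I_m}),
    volume n (kuhn z t) != 0); last first.
  rewrite big1 => [/esym/eqP|t _]; first by rewrite oner_eq0.
  rewrite big1// => z _; apply/eqP; apply: contrapT => /negP vtz; apply: v0.
  by exists t, z.
exists (kuhn z t); split=> [k i ni|k i|k k' kn kn' kk'].
- rewrite -[i]/(val (Ordinal ni)) kuhnE.
  by have := ltn_ord (z (Ordinal ni)); case: (_ < k)%N; lia.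
- case: (ltnP i n) => ni; last first.
    by rewrite (kuhn_out _ _ k ni) (kuhn_out _ _ 0 ni).
  by rewrite -[i]/(val (Ordinal ni)) !kuhnE; case: (_ < k)%N; lia.
- rewrite -ltnS in kn; rewrite -ltnS in kn'.
  by have /(congr1 val) := @volume_neq0_inj _ _ (Ordinal kn) (Ordinal kn') vtz kk'.
Qed.

End Sperner.

(** * Criteria for the dimensions of a metric space *)

Ltac lraR := repeat match goal with H : context [@EFin _] |- _ => clear H end; lra.
Ltac nraR := repeat match goal with H : context [@EFin _] |- _ => clear H end; nra.

Section Criteria.
Context {R : realType} (X : metricType R).
Implicit Types (A S : set X) (s t r delta lambda : R).

(** Unlike [covering_number], whose centers must lie in the set, this count passes to subsets. A
    class of diameter at most [r] lies in the ball around any of its points, so the count still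
    bounds [covering_number]. *)
Definition pcov S r n := exists phi : X -> nat,
  (forall x, S x -> (phi x < n)%N) /\
  (forall x y, S x -> S y -> phi x = phi y -> mdist x y <= r).

(** The factor 2 makes the balls of radius [r] disjoint, so the same points bound covering numbers
    and form packings. *)
Definition sep S r n := exists psi : nat -> X,
  (forall i, (i < n)%N -> S (psi i)) /\
  (forall i j, (i < j < n)%N -> 2 * r < mdist (psi i) (psi j)).

Lemma pcov_fin (I : finType) (phi : X -> I) S r :
  (forall x y, S x -> S y -> phi x = phi y -> mdist x y <= r) -> pcov S r #|I|.
Proof.
move=> phir; exists (fun x => val (enum_rank (phi x))); split => [x _|x y Sx Sy].
  exact: ltn_ord.
by move/val_inj/enum_rank_inj; apply: phir.
Qed.

Lemma pcovU S S' r n n' : pcov S r n -> pcov S' r n' ->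
  pcov (S `|` S') r (n + n').
Proof.
move=> [f [fn fr]] [g [gn gr]].
exists (fun x => if `[< S x >] then f x else (n + g x)%N); split.
  move=> x SSx; case: asboolP => [/fn|nSx]; first by lia.
  by case: SSx => // /gn; lia.
move=> x y SSx SSy; case: asboolP => [Sx|nSx]; case: asboolP => [Sy|nSy].
- exact: fr.
- by have := fn _ Sx; lia.
- by have := fn _ Sy; lia.
- by move=> /addnI; apply: gr; [case: SSx|case: SSy].
Qed.

Lemma sub_pcov S S' r n : S `<=` S' -> pcov S' r n -> pcov S r n.
Proof.
move=> SS [f [fn fr]]; exists f; split=> [x /SS/fn//|x y /SS Sx /SS Sy]; exact: fr.
Qed.

Lemma pcov_covering_number S r n : pcov S r n ->
  (covering_number S r <= n%:R%:E)%E.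
Proof.
move=> [f [fn fr]].
have [S0|/set0P[x0 Sx0]] := eqVneq S set0.
  apply: (@le_trans _ _ 0%:E); last by rewrite lee_fin.
  apply: ereal_inf_lbound; exists 0%N => //; exists set0; split=> //; first by rewrite II0.
  by rewrite S0.
pose g i := xget x0 [set x | S x /\ f x = i].
have gS i : S (g i).
  by rewrite /g; case: xgetP => [y _ []|].
have gf x : S x -> f (g (f x)) = f x.
  by move=> Sx; rewrite /g; case: xgetP => [y _ []//|/(_ x)[]].
have An : g @` `I_n #<= `I_n by exact: card_image_le.
have [k Ak] : exists k, g @` `I_n #= `I_k by apply/finite_setP/finite_set_leP; exists n.
have kn : (k <= n)%N.
  by rewrite -card_le_II -(card_le_eql Ak).
apply: (@le_trans _ _ k%:R%:E); last by rewrite lee_fin ler_nat.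
apply: ereal_inf_lbound; exists k => //; exists (g @` `I_n); split=> //.
  by move=> _ [i _ <-].
move=> x Sx; exists (g (f x)); first by exists (f x) => //; exact: fn.
by rewrite /cball /=; apply: fr => //; rewrite gf.
Qed.

Lemma sep_covering_number S r n : sep S r n ->
  (n%:R%:E <= covering_number S r)%E.
Proof.
move=> [f [fS fr]]; apply/ereal_infP => _ [k [A [AS Ak SA]] <-].
rewrite lee_fin ler_nat -card_le_II.
have /choice[g gP] (i : nat) : exists a, (i < n)%N -> A a /\ mdist a (f i) <= r.
  case: (ltnP i n) => ni; last by exists (f 0%N).
  by have [a Aa ?] := SA _ (fS _ ni); exists a.
rewrite -(card_le_eqr Ak).
have gA : g @` `I_n `<=` A by move=> _ [i /= ni <-]; have [] := gP i ni.
apply: card_le_trans (subset_card_le gA).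
suff gn : g @` `I_n #= `I_n by rewrite (card_le_eqr gn).
have lt i j : (i < j < n)%N -> g i <> g j.
  move=> /andP[ij jn] gij; have := fr i j; rewrite ij jn => /(_ isT).
  have [_ gi] := gP i (ltn_trans ij jn); have [_ gj] := gP j jn.
  rewrite -gij in gj; have tri := metric_triangle (f i) (g i) (f j).
  rewrite (metric_sym (f i) (g i)) in tri => fij; clear gij; lra.
apply: inj_card_eq => i j; rewrite !inE /= => ni nj gij.
by case: (ltngtP i j) => // ij; [case: (lt i j)|case: (lt j i)] => //; rewrite ij.
Qed.

Lemma lee_real_lt (a b : \bar R) : (forall s, (s%:E < a)%E -> (s%:E <= b)%E) ->
  (a <= b)%E.
Proof.
move=> ab; rewrite leNgt; apply/negP => ba.
have [s sb sa] : exists2 s, (b < s%:E)%E & (s%:E < a)%E.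
  case: a b {ab} ba => [a| |] [b| |] //= ba.
  - by exists ((a + b) / 2); move: ba; rewrite !lte_fin; lra.
  - by exists (a - 1); rewrite ?ltNyr// lte_fin; lra.
  - by exists (b + 1); rewrite ?ltry// lte_fin; lra.
  - by exists 0; rewrite ?ltNyr// ltry.
by have := ab _ sa; rewrite leNgt sb.
Qed.

Lemma lee_real_gt (a b : \bar R) : (forall s, (b < s%:E)%E -> (a <= s%:E)%E) ->
  (a <= b)%E.
Proof.
move=> ab; rewrite -leeN2; apply: lee_real_lt => s sb.
by rewrite leeNr -EFinN; apply: ab; rewrite EFinN lteNr.
Qed.

Lemma ereal_inf_real_le (P : set R) (a : \bar R) :
  (forall s, (a < s%:E)%E -> P s) -> (ereal_inf [set s%:E | s in P] <= a)%E.
Proof.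
move=> aP; apply: lee_real_gt => s /aP Ps.
by apply: ereal_inf_lbound; exists s.
Qed.

Lemma dim_A_le (a : \bar R) : (0 <= a)%E ->
  (forall s, (a < s%:E)%E -> exists2 C : R, 0 < C & forall (x : X) r r', 0 < r < r' ->
    exists2 n, pcov (cball x r') r n & n%:R <= C * (r' / r) `^ s) ->
  (dim_A X <= a)%E.
Proof.
move=> a0 aP; apply: ereal_inf_real_le => s as_; split.
  by rewrite -lte_fin (le_lt_trans a0).
have [C C0 CP] := aP _ as_; exists C => // x r r' /CP -/(_ x)[n xn nC].
by rewrite (le_trans (pcov_covering_number xn))// lee_fin.
Qed.

Lemma dim_A_ge (a : \bar R) :
  (forall s, 0 < s -> (s%:E < a)%E -> forall C : R, 0 < C -> exists (x : X) r r' n,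
    [/\ 0 < r < r', sep (cball x r') r n & C * (r' / r) `^ s < n%:R]) ->
  (a <= dim_A X)%E.
Proof.
move=> aP; apply/ereal_infP => _ [s [s0 [C C0 CP]] <-].
rewrite leNgt; apply/negP => sa.
have [x [r [r' [n [rr' xn nC]]]]] := aP s s0 sa C C0.
have := CP x r r' rr'; rewrite leNgt => /negP; apply.
by apply: lt_le_trans (sep_covering_number xn); rewrite lte_fin.
Qed.

Lemma hausdorff_dim_ge (a : \bar R) :
  (forall s, 0 <= s -> (s%:E < a)%E -> hausdorff_measure s [set: X] != 0%E) ->
  (a <= dim_H X)%E.
Proof.
move=> aP; apply/ereal_infP => _ [s [s0 Hs] <-].
by rewrite leNgt; apply/negP => /(aP _ s0)/eqP.
Qed.

Lemma packing_dim_ge (a : \bar R) :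
  (forall s, 0 <= s -> (s%:E < a)%E -> packing_measure s [set: X] != 0%E) ->
  (a <= dim_P X)%E.
Proof.
move=> aP; apply/ereal_infP => _ [s [s0 Hs] <-].
by rewrite leNgt; apply/negP => /(aP _ s0)/eqP.
Qed.

Lemma hausdorff_dim_le (a : \bar R) : (0 <= a)%E ->
  (forall s, 0 < s -> (a < s%:E)%E -> hausdorff_measure s [set: X] = 0%E) ->
  (dim_H X <= a)%E.
Proof.
move=> a0 aP; apply: ereal_inf_real_le => s as_.
have s0 : 0 < s by rewrite -lte_fin (le_lt_trans a0).
by split; [exact: ltW|exact: aP].
Qed.

Lemma packing_dim_le (a : \bar R) : (0 <= a)%E ->
  (forall s, 0 < s -> (a < s%:E)%E -> packing_measure s [set: X] = 0%E) ->
  (dim_P X <= a)%E.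
Proof.
move=> a0 aP; apply: ereal_inf_real_le => s as_.
have s0 : 0 < s by rewrite -lte_fin (le_lt_trans a0).
by split; [exact: ltW|exact: aP].
Qed.

Lemma dim_uB_ge (x0 : X) (a : \bar R) :
  (forall s (d : R), 0 <= s -> (s%:E < a)%E -> 0 < d -> exists r n,
     [/\ 0 < r < d, r < 1, sep [set: X] r n & r `^ (- s) <= n%:R]) ->
  (a <= dim_uB X)%E.
Proof.
move=> aP; rewrite /dim_uB limf_esupE; apply/ereal_infP => _ [V V0 <-].
apply: lee_real_lt => s sa.
have [d /= d0 dV] := V0.
have [r [n [/andP[r0 rd] r1 rn sn]]] : exists r n,
     [/\ 0 < r < d, r < 1, sep [set: X] r n & r `^ (- s) <= n%:R].
  (* For negative [s] a single point is enough, since the power of [r < 1] is then at most 1. *)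
  have [s0|s0] := leP 0 s; first exact: aP.
  exists (Num.min d 1 / 2), 1%N.
  have m0 : 0 < Num.min d 1 by rewrite lt_min d0 ltr01.
  have md : Num.min d 1 <= d by rewrite ge_min lexx.
  have m1 : Num.min d 1 <= 1 by rewrite ge_min lexx orbT.
  split; [apply/andP; split|..]; try lraR.
    by exists (fun=> x0); split => // i j; lia.
  have <- : 1 `^ (- s) = 1%:R :> R by rewrite powR1.
  apply: ge0_ler_powR; rewrite ?nnegrE; lraR.
apply: (@le_trans _ _ (lne (covering_number [set: X] r) / (- ln r)%:E)%E); last first.
  apply: ereal_sup_ubound; exists r => //; apply: dV => //=.
  by rewrite sub0r normrN gtr0_norm.
have lnr : 0 < - ln r by rewrite oppr_gt0 ln_lt0// r0.
rewrite inver gt_eqF// lee_pdivlMr// -EFinM.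
have n0 : 0 < n%:R :> R by apply: lt_le_trans sn; exact: powR_gt0.
apply: (@le_trans _ _ (lne n%:R%:E)).
  rewrite lne_EFin// lee_fin; move: sn; rewrite -ler_ln ?posrE ?powR_gt0//.
  by rewrite ln_powR mulrN mulNr.
have n0E : (0 <= n%:R%:E :> \bar R)%E by rewrite lee_fin ltW.
have ncov := sep_covering_number rn.
by rewrite lee_lne ?in_itv //= ?leey ?n0E //= (le_trans n0E).
Qed.

Lemma dim_uB_le (a : \bar R) : (0 <= a)%E ->
  (forall s, (a < s%:E)%E -> exists2 C : R, 0 < C & forall r, 0 < r < 1 ->
    exists2 n, pcov [set: X] r n & n%:R <= C * r `^ (- s)) ->
  (dim_uB X <= a)%E.
Proof.
move=> a0 aP; rewrite /dim_uB limf_esupE; apply: lee_real_gt => s as_.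
have [t at_ ts] : exists2 t, (a < t%:E)%E & t < s.
  case: a a0 as_ {aP} => [a| |] //; rewrite !lte_fin lee_fin => a0 as_.
  by exists ((a + s) / 2); rewrite ?lte_fin; lra.
have [C C0 CP] := aP _ at_.
pose D : R := Num.max C 1; have D1 : 1 <= D by rewrite le_max lexx orbT.
have D0 : 0 < D by rewrite (lt_le_trans ltr01).
have CD : C <= D by rewrite le_max lexx.
have lnD : 0 <= ln D by rewrite ln_ge0.
(* r is small enough that ln D <= (s - t) (- ln r) *)
pose d := Num.min (expR (- (ln D / (s - t)))) 1.
have d0 : 0 < d by rewrite lt_min expR_gt0 ltr01.
apply: ge_ereal_inf.
pose V := [set r : R | 0 < r < d].
exists (ereal_sup [set lne (covering_number [set: X] r) / (- ln r)%:E | r in V])%E.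
  exists V => //; exists d => //= y /=; rewrite sub0r normrN /V /= => yd y0.
  by rewrite y0 -(gtr0_norm y0).
apply/ereal_supP => _ [r /andP[r0 rd] <-].
have r1 : r < 1 by apply: lt_le_trans rd _; rewrite ge_min lexx orbT.
have lnr : 0 < - ln r by rewrite oppr_gt0 ln_lt0// r0.
rewrite inver gt_eqF// lee_pdivrMr// -EFinM.
have [n rn nC] : exists2 n, pcov [set: X] r n & n%:R <= C * r `^ (- t).
  by apply: CP; rewrite r0.
have covn := pcov_covering_number rn.
have [n0|n0] := leP (covering_number [set: X] r) 0%E.
  by rewrite le0_lneNy// leNye.
have n0' : 0 < n%:R :> R by rewrite -lte_fin (lt_le_trans n0).
apply: (@le_trans _ _ (lne n%:R%:E)).
  by rewrite lee_lne ?in_itv //= ?leey ?ltW.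
rewrite lne_EFin// lee_fin.
have : ln n%:R <= ln (D * r `^ (- t)).
  rewrite ler_ln ?posrE// ?mulr_gt0 ?powR_gt0//.
  by apply: le_trans nC _; rewrite ler_wpM2r// powR_ge0.
rewrite lnM ?posrE ?powR_gt0// ln_powR => /le_trans; apply.
suff : ln D <= (s - t) * - ln r by nraR.
have st : 0 < s - t by rewrite subr_gt0.
rewrite -ler_pdivrMl// mulrC -lerN2 opprK -ler_expR lnK ?posrE//.
by apply: ltW; apply: lt_le_trans rd _; rewrite ge_min lexx.
Qed.

End Criteria.

Lemma powRXn (R : realType) (x s : R) k : 0 <= x -> (x ^+ k) `^ s = (x `^ s) ^+ k.
Proof.
move=> x0; elim: k => [|k IHk]; first by rewrite !expr0 powR1.
by rewrite !exprS powRM ?exprn_ge0// IHk.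
Qed.

Lemma powR_half (R : realType) (s : R) : 2^-1 `^ (- s) = 2 `^ s.
Proof. by rewrite -powR_inv1 ?ler0n// -powRrM mulN1r opprK. Qed.

(** * Vanishing and positivity of Hausdorff and packing measures *)

Section Measures.
Context {R : realType} (X : metricType R).
Implicit Types (A S : set X) (s t r delta lambda : R).

Lemma diam_ge0 A : (0 <= diam A)%E.
Proof. by rewrite /diam le_max lexx. Qed.

Lemma diam_le A r : 0 <= r -> (forall x y, A x -> A y -> mdist x y <= r) ->
  (diam A <= r%:E)%E.
Proof.
move=> r0 Ar; rewrite /diam ge_max lee_fin r0; apply/ereal_supP => _ [[x y] [Ax Ay] <-].
by rewrite lee_fin; exact: Ar.
Qed.

Lemma mdist_diam A x y : A x -> A y -> ((mdist x y)%:E <= diam A)%E.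
Proof.
move=> Ax Ay; rewrite /diam le_max; apply/orP; right.
by apply: ereal_sup_ubound; exists (x, y).
Qed.

(* Mass distribution principle for the image of Lebesgue measure under b. *)
Lemma hausdorff_measure_neq0 (b : R -> X) s (K : R) : 0 <= s -> 0 < K ->
  (forall t t', 0 <= t < 1 -> 0 <= t' < 1 ->
    `|t - t'| <= K * (mdist (b t) (b t')) `^ s) ->
  hausdorff_measure s [set: X] != 0%E.
Proof.
move=> s0 K0 bK; rewrite gt_eqF//.
have K2 : 0 < 2 * K by rewrite mulr_gt0.
apply: (@lt_le_trans _ _ ((2 * K)^-1%:E)); first by rewrite lte_fin invr_gt0.
apply: le_trans (_ : hausdorff_pre s 1 [set: X] <= _)%E; last first.
  by apply: ereal_sup_ubound; exists 1 => //=.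
apply/ereal_infP => _ [F [XF F1] <-].
have diamE i : F i !=set0 -> exists2 d, 0 <= d & diam (F i) = d%:E.
  move=> _; have := F1 i; have := diam_ge0 (F i).
  by case: (diam (F i)) => // d; rewrite lee_fin => d0 _; exists d.
pose I : set R := `[0, 1[%classic.
(* The preimage of [F i] need not be measurable. A closed interval centered at one of its points, of
   length [2 * K] times the power of the diameter, replaces it. *)
have /choice[G GP] (i : nat) : exists G : set R, [/\ measurable G,
    I `&` b @^-1` F i `<=` G &
    (lebesgue_measure G <=
      if F i != set0 then (2 * K)%:E * diam (F i) `^ s else 0)%E].
  have [Gi0|/set0P[t [It /= Ft]]] := eqVneq (I `&` b @^-1` F i) set0.
    exists set0; rewrite measure0 Gi0; split=> //.
    by case: ifP => // _; apply: mule_ge0; [rewrite lee_fin ltW|exact: poweR_ge0].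
  have Fi0 : F i != set0 by apply/set0P; exists (b t).
  have [d d0 dE] := diamE i (ex_intro _ _ Ft).
  pose h := K * d `^ s; have h0 : 0 <= h by rewrite mulr_ge0 ?powR_ge0// ltW.
  exists `[t - h, t + h]%classic; split=> //.
    move=> t' [It' /= Ft']; rewrite /= in_itv /=.
    have tt' : `|t - t'| <= h.
      move: It It'; rewrite /I /= !in_itv /= => It It'.
      apply: le_trans (bK _ _ It It') _; apply: ler_wpM2l; first exact: ltW.
      apply: ge0_ler_powR; rewrite ?nnegrE ?mdist_ge0//.
      by have := mdist_diam Ft Ft'; rewrite dE lee_fin.
    by move: tt'; rewrite ler_norml => /andP[]; lraR.
  rewrite Fi0 dE poweR_EFin -EFinM lebesgue_measure_itv /= lte_fin.
  by rewrite -mulrA -/h; case: ifP => _; rewrite -?EFinB lee_fin; lraR.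
rewrite -(@lee_pmul2l _ (2 * K)%:E)// -EFinM mulfV ?gt_eqF//.
rewrite -nneseriesZl; last by move=> i _; exact: poweR_ge0.
rewrite eseries_mkcond.
have <- : lebesgue_measure I = 1%E :> \bar R.
  by rewrite lebesgue_measure_itv /= lte_fin ltr01 oppr0 adde0.
apply: (@le_trans _ _ (\sum_(i <oo) lebesgue_measure (G i))%E).
  apply: measure_sigma_subadditive => //.
  - by move=> i; have [] := GP i.
  - exact: measurable_itv.
  - move=> t It; have [i _ Fit] := XF (b t) Logic.I.
    by exists i => //; have [_ + _] := GP i; apply.
apply: lee_nneseries => [i _ _|i _]; first exact: measure_ge0.
by have [] := GP i.
Qed.

(** Singletons have diameter 0, and a positive power of 0 is 0, so the countable part is covered for
    free; the rest is covered by classes at a single scale. *)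
Lemma hausdorff_measure_eq0 A (c : nat -> X) s : 0 < s ->
  [set: X] `<=` A `|` range c ->
  (forall eps delta, 0 < eps -> 0 < delta -> exists r n,
    [/\ 0 < r < delta, pcov A r n & n%:R * r `^ s <= eps]) ->
  hausdorff_measure s [set: X] = 0%E.
Proof.
move=> s0 XAc AP; apply/eqP; rewrite eq_le; apply/andP; split; last first.
  apply: le_trans (_ : hausdorff_pre s 1 [set: X] <= _)%E; last first.
    by apply: ereal_sup_ubound; exists 1 => //=.
  apply/ereal_infP => _ [F _ <-]; apply: nneseries_ge0 => i _ _; exact: poweR_ge0.
apply/ereal_supP => _ [delta /= delta0 <-].
apply/lee_addgt0Pr => eps eps0; rewrite add0e.
have [r [n [/andP[r0 rdelta] [f [fn fr]] nr]]] := AP _ _ eps0 delta0.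
pose F i := if (i < n)%N then A `&` [set x | f x = i] else [set c (i - n)%N].
have diamF i : (diam (F i) <= (if (i < n)%N then r else 0)%:E)%E.
  rewrite /F; case: ifP => ni; apply: diam_le => //; first exact: ltW.
    by move=> x y [Ax fx] [Ay fy]; apply: fr => //; rewrite fx fy.
  by move=> x y -> ->; rewrite mdistxx.
apply: ge_ereal_inf.
exists (\sum_(i <oo | F i != set0) diam (F i) `^ s)%E.
  exists F => //; split => [x _|i].
    have [Ax|[i _ <-]] := XAc x Logic.I.
      by exists (f x) => //; rewrite /F fn.
    by exists (n + i)%N => //; rewrite /F ltnNge leq_addr /= addKn.
  apply: le_lt_trans (diamF i) _; rewrite lte_fin; case: ifP => // _.
rewrite (nneseries_split_cond 0 n); last by move=> *; exact: poweR_ge0.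
rewrite add0n [X in (_ + X)%E]eseries0 ?adde0; last first.
  move=> i ni _; have := diamF i; rewrite ltnNge ni /= => di.
  have -> : diam (F i) = 0%E by apply/eqP; rewrite eq_le di diam_ge0.
  by rewrite poweR0r// gt_eqF.
apply: (@le_trans _ _ (\sum_(0 <= i < n) (r `^ s)%:E)%E).
  rewrite big_mkcond /= !big_nat; apply: lee_sum => i /andP[_ ni].
  have := diamF i; rewrite ni => di.
  case: ifP => _; last by rewrite lee_fin powR_ge0.
  rewrite -poweR_EFin; have := diam_ge0 (F i).
  case: (diam (F i)) di => [d| |]//; rewrite !lee_fin => dr d0.
  by apply: ge0_ler_powR => //; rewrite ?nnegrE//; exact: ltW.
by rewrite sumEFin sumr_const_nat subn0 lee_fin -mulr_natl.
Qed.

Lemma sep_packing_pre S s r delta n : 0 < r < delta -> sep S r n ->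
  ((n%:R * r `^ s)%:E <= packing_pre s delta S)%E.
Proof.
move=> /andP[r0 rd] [f [fS fr]].
have finj i j : (i < n)%N -> (j < n)%N -> f i = f j -> i = j.
  move=> ni nj fij; case: (ltngtP i j) => // ij.
    have := fr i j; rewrite ij nj fij mdistxx => /(_ isT).
    by rewrite ltNge mulr_ge0 // ltW.
  have := fr j i; rewrite ij ni fij mdistxx => /(_ isT).
  by rewrite ltNge mulr_ge0 // ltW.
pose g i := (f i, r).
apply: (@le_trans _ _ (\esum_(p in g @` `I_n) (p.2 `^ s)%:E)%E).
  have ginj : {in `I_n &, injective g}.
    by move=> i j; rewrite !inE /= => ni nj [/finj]; apply.
  rewrite esum_image//.
  rewrite esum_fset //; last by move=> i _; rewrite lee_fin powR_ge0.
  by rewrite -fsbig_ord /= sumEFin sumr_const card_ord mulr_natl.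
apply: ereal_sup_ubound; exists (g @` `I_n) => //; split.
- exact/finite_set_countable/finite_image/finite_II.
- by move=> _ [i ni <-] /=; split; [exact: fS|rewrite r0].
- move=> _ _ [i /= ni <-] [j /= nj <-] [y [/= iy jy]].
  have ij_le : mdist (f i) (f j) <= 2 * r.
    rewrite mulr_natl mulr2n; apply: le_trans (metric_triangle _ y _) _.
    by rewrite lerD// metric_sym.
  congr (f _, r); case: (ltngtP i j) => // ij.
    by have := fr i j; rewrite ij nj ltNge ij_le => /(_ isT).
  by have := fr j i; rewrite ij ni ltNge metric_sym ij_le => /(_ isT).
Qed.

Lemma packing_measure_neq0 s :
  (forall S : (set X)^nat, [set: X] `<=` \bigcup_i S i ->
    exists i, forall delta, 0 < delta -> exists r n,
      [/\ 0 < r < delta, sep (S i) r n & 1 <= n%:R * r `^ s]) ->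
  packing_measure s [set: X] != 0%E.
Proof.
move=> SP; rewrite gt_eqF//; apply: (@lt_le_trans _ _ 1%E) => //.
have pre_ge0 S delta : (0 <= packing_pre s delta S)%E.
  apply: ereal_sup_ubound; exists set0; last by rewrite esum_set0.
  by split => // x y [].
have pre0_ge0 S : (0 <= packing_pre0 s S)%E.
  by apply/ereal_infP => _ [delta _ <-].
apply/ereal_infP => _ [S XS <-]; have [i Si] := SP S XS.
apply: (@le_trans _ _ (packing_pre0 s (S i))).
  apply/ereal_infP => _ [delta /= d0 <-]; have [r [n [rd Sr nr]]] := Si _ d0.
  by apply: le_trans (sep_packing_pre s rd Sr); rewrite lee_fin.
apply: (@le_trans _ _ (\sum_(0 <= k < i.+1) packing_pre0 s (S k))%E).
  by rewrite big_nat_recr//= leeDr// sume_ge0.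
exact: nneseries_lim_ge.
Qed.

(** Disjointness enters only through the fact that no ball contains the center of another; a class
    of diameter at most [r] then holds at most one center. *)
Lemma packing_size A (L : seq (X * R)) r n : uniq L ->
  (forall p, p \in L -> A p.1 /\ r <= p.2) ->
  (forall p p', p \in L -> p' \in L -> mdist p.1 p'.1 <= p.2 -> p = p') ->
  pcov A r n -> (size L <= n)%N.
Proof.
move=> Lu LA Ld [f [fn fr]]; rewrite -(size_map (fun p => f p.1)) -(size_iota 0 n).
apply: uniq_leq_size.
  rewrite map_inj_in_uniq// => p p' pL p'L fpp'; apply: Ld => //.
  have [Ap rp] := LA _ pL; have [Ap' _] := LA _ p'L.
  exact: le_trans (fr _ _ Ap Ap' fpp') rp.
by move=> _ /mapP[p /LA[Ap _] ->]; rewrite mem_iota /= fn.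
Qed.

(** The radii are sorted into [m] dyadic shells. The shell from [2^-(i+1)] to [2^-i] holds at most
    [C 2^(t(i+1))] balls, each contributing at most [2^-(s i)]; the product is the [i]-th term of
    the sum. *)
Lemma packing_sum_le A s t (C : R) : 0 <= t < s -> 0 <= C ->
  (forall r, 0 < r <= 1 -> exists2 n, pcov A r n & n%:R <= C * r `^ (- t)) ->
  forall (m k : nat) (L : seq (X * R)), uniq L ->
  (forall p, p \in L -> A p.1 /\ 2^-1 ^+ (k + m) <= p.2 < 2^-1 ^+ k) ->
  (forall p p', p \in L -> p' \in L -> mdist p.1 p'.1 <= p.2 -> p = p') ->
  \sum_(p <- L) p.2 `^ s <=
    C * 2 `^ t * \sum_(k <= i < k + m) (2^-1 `^ (s - t)) ^+ i.
Proof.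
move=> /andP[t0 ts] C0 AC; have s0 : 0 <= s by rewrite (le_trans t0)// ltW.
have [h hE] : exists h : R, h = 2^-1 by exists 2^-1.
have h0 : 0 < h by rewrite hE invr_gt0 ltr0n.
have h1 : h <= 1 by rewrite hE invf_le1 ?ler1n ?ltr0n//.
rewrite -hE.
elim=> [|m IHm] k L Lu LA Ld.
  case: L LA {Lu Ld} => [|p L LA].
    by rewrite big_nil addn0 big_geq// mulr0.
  by have [_] := LA p (mem_head _ _); rewrite addn0 => /andP[/le_lt_trans hp /hp]; rewrite ltxx.
rewrite (bigID (fun p => h ^+ k.+1 <= p.2)) /=.
rewrite -[X in X + _]big_filter -[X in _ + X]big_filter.
rewrite big_ltn ?addnS ?ltnS ?leq_addr// mulrDr; apply: lerD; last first.
  rewrite -addSn; apply: IHm; first exact: filter_uniq.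
    move=> p; rewrite mem_filter -ltNge => /andP[pk /LA[Ap /andP[pkm _]]].
    by split => //; rewrite pk addSn -addnS pkm.
  by move=> p p'; rewrite !mem_filter => /andP[_ pL] /andP[_]; exact: Ld.
set L1 := seq.filter _ _.
have hk0 : 0 < h ^+ k.+1 by rewrite exprn_gt0.
have [n An nC] : exists2 n, pcov A (h ^+ k.+1) n & n%:R <= C * (h ^+ k.+1) `^ (- t).
  apply: AC; by rewrite hk0 exprn_ile1// ltW.
have L1n : (size L1 <= n)%N.
  apply: (packing_size _ _ _ An); first exact: filter_uniq.
    by move=> p; rewrite mem_filter => /andP[-> /LA[Ap _]].
  by move=> p p'; rewrite !mem_filter => /andP[_ pL] /andP[_]; exact: Ld.
apply: (@le_trans _ _ (\sum_(p <- L1) (h ^+ k) `^ s)).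
  rewrite big_seq [leRHS]big_seq; apply: ler_sum => p.
  rewrite mem_filter => /andP[hp /LA[_ /andP[_ ph]]].
  by apply: ge0_ler_powR; rewrite ?nnegrE ?exprn_ge0//; apply: ltW => //; exact: lt_le_trans hp.
rewrite big_const_seq count_predT iter_addr_0 -[leLHS]mulr_natl.
apply: (@le_trans _ _ (n%:R * (h ^+ k) `^ s)).
  by rewrite ler_wpM2r ?powR_ge0// ler_nat.
apply: (@le_trans _ _ (C * (h ^+ k.+1) `^ (- t) * (h ^+ k) `^ s)).
  by rewrite ler_wpM2r ?powR_ge0.
have hs : h `^ s = h `^ (s - t) * h `^ t.
  by rewrite -powRD ?subrK// (gt_eqF h0) implybT.
have ht : h `^ (- t) * h `^ t = 1.
  by rewrite -powRD ?addNr ?powRr0// (gt_eqF h0) implybT.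
rewrite !powRXn ?(ltW h0)// hs -powR_half -hE exprS exprMn.
suff -> : C * (h `^ (- t) * (h `^ (- t)) ^+ k) * ((h `^ (s - t)) ^+ k * (h `^ t) ^+ k) =
    C * h `^ (- t) * (h `^ (s - t)) ^+ k * (h `^ (- t) * h `^ t) ^+ k.
  by rewrite ht expr1n mulr1.
by rewrite exprMn; ring.
Qed.

Lemma expr_lt_eps (q eps : R) : 0 <= q < 1 -> 0 < eps -> exists k, q ^+ k < eps.
Proof.
move=> /andP[q0 q1] eps0.
have := @cvg_expr R q; rewrite ger0_norm// => /(_ q1)/cvgrPdist_lt/(_ _ eps0)[k _ kP].
exists k; have := kP k (leqnn k); rewrite sub0r normrN ger0_norm//.
exact: exprn_ge0.
Qed.

Lemma geo_sum_le (q : R) k m : 0 <= q < 1 ->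
  \sum_(k <= i < k + m) q ^+ i <= q ^+ k / (1 - q).
Proof.
move=> /andP[q0 q1]; have q1' : 0 < 1 - q by rewrite subr_gt0.
rewrite ler_pdivlMr// (_ : _ * _ = q ^+ k - q ^+ (k + m)).
  by rewrite lerBlDr lerDl exprn_ge0.
elim: m => [|m IHm]; first by rewrite addn0 big_geq// mul0r subrr.
by rewrite addnS big_nat_recr ?leq_addr//= mulrDl IHm exprS; ring.
Qed.

Lemma packing_pre0_eq0 A s t (C : R) : 0 <= t < s -> 0 <= C ->
  (forall r, 0 < r <= 1 -> exists2 n, pcov A r n & n%:R <= C * r `^ (- t)) ->
  (packing_pre0 s A <= 0)%E.
Proof.
move=> ts C0 AC; apply/lee_addgt0Pr => eps eps0; rewrite add0e.
set q := 2^-1 `^ (s - t).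
have q01 : 0 <= q < 1.
  have ts' : 0 < s - t by rewrite subr_gt0; case/andP: ts.
  rewrite powR_ge0 /q; have : (2^-1 : R) `^ (s - t) < 1 `^ (s - t).
    by apply: gt0_ltr_powR => //; rewrite ?nnegrE ?invr_ge0 ?ler0n ?ler01 ?invf_lt1 ?ltr1n ?ltr0n.
  by rewrite powR1.
have q1 : 0 < 1 - q by rewrite subr_gt0; case/andP: q01.
pose D := C * 2 `^ t / (1 - q).
have D0 : 0 <= D by rewrite divr_ge0 ?mulr_ge0 ?powR_ge0// ltW.
have D1 : 0 < D + 1 by rewrite ltr_wpDl.
(* Packings with radii below [2^-k] see only the tail of the geometric series from [k] on. [D + 1]
   replaces [D], which may be 0. *)
have [k kP] : exists k, C * 2 `^ t * (q ^+ k / (1 - q)) <= eps.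
  have [k kP] := expr_lt_eps q01 (divr_gt0 eps0 D1).
  exists k; rewrite mulrA mulrAC -/D.
  apply: le_trans (_ : D * (eps / (D + 1)) <= _).
    by apply: ler_wpM2l => //; exact: ltW.
  rewrite mulrA ler_pdivrMr// mulrC; apply: ler_wpM2l; first exact: ltW.
  by rewrite lerDl ler01.
apply: ge_ereal_inf; exists (packing_pre s (2^-1 ^+ k) A).
  by exists (2^-1 ^+ k) => //=; rewrite exprn_gt0 ?invr_gt0.
apply/ereal_supP => _ [Q [_ QA Qdisj] <-]; apply/ereal_supP => _ [F [Ffin FQ] <-].
rewrite fsbig_finite//= sumEFin lee_fin.
have LQ p : p \in finmap.enum_fset (fset_set F) -> Q p.
  by move=> pF; apply: FQ; rewrite -inE -in_fset_set.
have Lu : uniq (finmap.enum_fset (fset_set F)) by exact: finmap.fset_uniq.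
move: (finmap.enum_fset _) LQ Lu => L LQ Lu {F Ffin FQ}.
(* The sum is a supremum over finite subfamilies, whose radii are bounded below, so finitely many
   shells suffice. *)
have [m mP] : exists m, forall p, p \in L -> 2^-1 ^+ m <= p.2.
  have L0 p : p \in L -> 0 < p.2 by move=> /LQ/QA[_ /andP[]].
  elim: L L0 {LQ Lu} => [|p L IHL] L0; first by exists 0%N.
  have [m1 m1P] : exists m, forall p, p \in L -> 2^-1 ^+ m <= p.2.
    by apply: IHL => p' p'L; apply: L0; rewrite inE p'L orbT.
  have h01 : 0 <= (2^-1 : R) < 1 by rewrite invr_ge0 ler0n invf_lt1 ?ltr1n ?ltr0n//.
  have [m2 m2P] := expr_lt_eps h01 (L0 p (mem_head _ _)).
  case/andP: h01 => h0 h1.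
  exists (m1 + m2)%N => p'; rewrite inE => /predU1P[->|/m1P].
    apply: le_trans (ltW m2P); rewrite exprD ler_piMl ?exprn_ge0//.
    by rewrite exprn_ile1// ltW.
  by apply: le_trans; rewrite exprD ler_piMr ?exprn_ge0// exprn_ile1// ltW.
apply: le_trans kP.
apply: (@le_trans _ _ (C * 2 `^ t * \sum_(k <= i < k + m) q ^+ i)); last first.
  by rewrite ler_wpM2l ?geo_sum_le// mulr_ge0 ?powR_ge0.
apply: (packing_sum_le ts C0 AC) => // [p pL|p p' pL p'L pp'].
  have [Ap /andP[p0 pk]] := QA _ (LQ _ pL); split => //; rewrite pk andbT.
  apply: le_trans (mP _ pL); rewrite exprD ler_piMl ?exprn_ge0 ?invr_ge0 ?ler0n//.
  by rewrite exprn_ile1 ?invr_ge0 ?ler0n// invf_le1 ?ler1n ?ltr0n//.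
apply: Qdisj; [exact: LQ|exact: LQ|exists p'.1]; split => //=.
have [_ /andP[p0 _]] := QA _ (LQ _ p'L).
by rewrite /cball /= mdistxx ltW.
Qed.

Lemma packing_measure_eq0 A (c : nat -> X) s t (C : R) : 0 <= t < s -> 0 <= C ->
  [set: X] `<=` A `|` range c ->
  (forall r, 0 < r <= 1 -> exists2 n, pcov A r n & n%:R <= C * r `^ (- t)) ->
  packing_measure s [set: X] = 0%E.
Proof.
move=> ts C0 XAc AP; apply/eqP; rewrite eq_le; apply/andP; split; last first.
  apply/ereal_infP => _ [S _ <-]; apply: nneseries_ge0 => i _ _.
  apply/ereal_infP => _ [delta _ <-].
  apply: ereal_sup_ubound; exists set0; last by rewrite esum_set0.
  by split => // x y [].
apply: ge_ereal_inf.
pose S i := if i is j.+1 then [set c j] else A.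
exists (\sum_(i <oo) packing_pre0 s (S i))%E.
  exists S => // x _; have [Ax|[i _ <-]] := XAc x Logic.I.
    by exists 0%N.
  by exists i.+1.
rewrite eseries0// => i _ _; apply/eqP; rewrite eq_le; apply/andP; split; last first.
  apply/ereal_infP => _ [delta _ <-].
  apply: ereal_sup_ubound; exists set0; last by rewrite esum_set0.
  by split => // x y [].
case: i => [|i] /=; first exact: packing_pre0_eq0 AP.
(* A singleton obeys the counting bound with exponent 0. *)
apply: (@packing_pre0_eq0 _ s 0 1) => //.
  by rewrite lexx; case/andP: ts => /le_lt_trans; exact.
move=> r /andP[r0 _]; exists 1%N; last by rewrite oppr0 powRr0 mulr1.
by exists (fun=> 0%N); split => // x y -> ->; rewrite mdistxx ltW.
Qed.

End Measures.

(** * The building blocks *)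

(** With diameters at most 1, putting two pieces at mutual distance 1 respects the triangle
    inequality and yields a space of the same kind. *)
Record mspace (R : realType) := MSpace {
  mpt : Type;
  mspace_dist : mpt -> mpt -> R;
  mspace_distxx : forall x, mspace_dist x x = 0;
  mspace_dist_eq0 : forall x y, mspace_dist x y = 0 -> x = y;
  mspace_sym : forall x y, mspace_dist x y = mspace_dist y x;
  mspace_tri : forall y x z, mspace_dist x z <= mspace_dist x y + mspace_dist y z;
  mspace_le1 : forall x y, mspace_dist x y <= 1 }.

Definition metric_of (R : realType) (M : mspace R) : Type := mpt M.

HB.instance Definition _ (R : realType) (M : mspace R) :=
  gen_eqMixin (metric_of M).
HB.instance Definition _ (R : realType) (M : mspace R) :=
  gen_choiceMixin (metric_of M).
HB.instance Definition _ (R : realType) (M : mspace R) :=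
  @isMetric.Build R (metric_of M) (@mspace_dist R M) (@mspace_distxx R M)
    (@mspace_dist_eq0 R M) (@mspace_sym R M) (@mspace_tri R M).

(** * Disjoint sums *)

Section Sum.
Context {R : realType}.
Implicit Types M N : mspace R.

Lemma mdistE M (x y : metric_of M) : mdist x y = mspace_dist x y.
Proof. by []. Qed.

Lemma mdist_le1 M (x y : metric_of M) : mdist x y <= 1.
Proof. exact: mspace_le1. Qed.

Section Def.
Variables M N : mspace R.

Definition sum_dist (x y : mpt M + mpt N) : R :=
  match x, y with
  | inl x, inl y => mspace_dist x y
  | inr x, inr y => mspace_dist x y
  | _, _ => 1
  end.

Fact sum_distxx x : sum_dist x x = 0.
Proof. by case: x => x /=; exact: mspace_distxx. Qed.

Fact sum_dist_eq0 x y : sum_dist x y = 0 -> x = y.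
Proof.
case: x y => [x|x] [y|y] /= d0.
- by rewrite (mspace_dist_eq0 d0).
- by move/eqP: d0; rewrite oner_eq0.
- by move/eqP: d0; rewrite oner_eq0.
- by rewrite (mspace_dist_eq0 d0).
Qed.

Fact sum_dist_sym x y : sum_dist x y = sum_dist y x.
Proof. by case: x y => [x|x] [y|y] //=; exact: mspace_sym. Qed.

Fact mspace_dist_ge0 (P : mspace R) (x y : mpt P) : 0 <= mspace_dist x y.
Proof. exact: (@mdist_ge0 _ (metric_of P)). Qed.

Fact sum_dist_tri y x z : sum_dist x z <= sum_dist x y + sum_dist y z.
Proof.
case: x y z => [x|x] [y|y] [z|z] /=; try exact: mspace_tri.
- by rewrite lerDr mspace_dist_ge0.
- by apply: le_trans (mspace_le1 _ _) _; rewrite lerDl ler01.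
- by rewrite lerDl mspace_dist_ge0.
- by rewrite lerDl mspace_dist_ge0.
- by apply: le_trans (mspace_le1 _ _) _; rewrite lerDl ler01.
- by rewrite lerDr mspace_dist_ge0.
Qed.

Fact sum_dist_le1 x y : sum_dist x y <= 1.
Proof. by case: x y => [x|x] [y|y] //=; exact: mspace_le1. Qed.

Definition sum_mspace :=
  MSpace sum_distxx sum_dist_eq0 sum_dist_sym sum_dist_tri sum_dist_le1.

Lemma continuous_isometry (X Y : metricType R) (f : X -> Y) :
  (forall x y, mdist (f x) (f y) <= mdist x y) -> continuous f.
Proof.
move=> fd x; apply/cvg_ballP => e e0; near=> y; rewrite ballEmdist /=.
apply: le_lt_trans (fd _ _) _.
suff : ball x e y by rewrite ballEmdist.
by near: y; exact: nbhsx_ballx.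
Unshelve. all: by end_near. Qed.

Lemma compact_sum : compact [set: metric_of M] -> compact [set: metric_of N] ->
  compact [set: metric_of sum_mspace].
Proof.
move=> cM cN.
pose i1 (x : metric_of M) : metric_of sum_mspace := inl x.
pose i2 (x : metric_of N) : metric_of sum_mspace := inr x.
have -> : [set: metric_of sum_mspace] = i1 @` setT `|` i2 @` setT.
  apply/seteqP; split => // -[x|x] _; [left|right]; by exists x.
apply: compactU; apply: continuous_compact => //;
  by apply: continuous_subspaceT; apply: continuous_isometry.
Qed.

End Def.
End Sum.

(** * Cantor sets with prescribed radii *)

Record scale (R : realType) := Scale {
  sc :> nat -> R;
  sc0 : sc 0%N = 0;
  sc_mono : forall i j, (i <= j)%N -> sc i <= sc j;
  sc_unbounded : forall M : R, exists j, M <= sc j }.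

Section CantorDistance.
Context {R : realType} (e : scale R).
Implicit Types (x y : nat -> bool) (r : R).

Definition rad j : R := 2 `^ (- e j).

Lemma rad_gt0 j : 0 < rad j.
Proof. exact: powR_gt0. Qed.

Lemma rad_anti i j : (i <= j)%N -> rad j <= rad i.
Proof.
by move=> ij; apply: ler_powR; rewrite ?ler1n// lerN2 sc_mono.
Qed.

Lemma rad0 : rad 0 = 1.
Proof. by rewrite /rad sc0 oppr0 powRr0. Qed.

Lemma rad_le1 j : rad j <= 1.
Proof. by rewrite -rad0 rad_anti. Qed.

Lemma rad_small r : 0 < r -> exists j, rad j <= r.
Proof.
move=> r0; have [j ej] := sc_unbounded e (- (ln r / ln 2)); exists j.
have ln2 : 0 < ln 2 :> R by rewrite ln_gt0// ltr1n.
rewrite -ler_ln ?posrE ?rad_gt0// ln_powR mulNr -lerN2 opprK.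
by rewrite -ler_pdivrMr// mulNr.
Qed.

(** For positive [r] the closed ball of radius [r] is the cylinder fixing the first [level r]
    coordinates, so counting in balls is counting words. *)
Definition level r : nat :=
  if pselect (exists j, rad j <= r) is left h then ex_minn h else 0%N.

Lemma rad_level r : 0 < r -> rad (level r) <= r.
Proof.
by rewrite /level => /rad_small h; case: pselect => // h'; case: ex_minnP.
Qed.

Lemma lt_level r i : (i < level r)%N -> r < rad i.
Proof.
rewrite /level; case: pselect => // h; case: ex_minnP => j _ jmin ij.
by rewrite ltNge; apply/negP => /jmin; rewrite leqNgt ij.
Qed.

Lemma level_anti r r' : 0 < r -> r <= r' -> (level r' <= level r)%N.
Proof.
move=> r0 rr'; rewrite leqNgt; apply/negP => /lt_level.
by rewrite ltNge (le_trans (rad_level r0)).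
Qed.

Definition cdist x y : R :=
  if pselect (exists i, x i != y i) is left h then rad (ex_minn h) else 0.

Variant cdist_spec x y : R -> Prop :=
  | CdistEq of x = y : cdist_spec x y 0
  | CdistDiff i of (forall j, (j < i)%N -> x j = y j) & x i != y i :
      cdist_spec x y (rad i).

Lemma cdistP x y : cdist_spec x y (cdist x y).
Proof.
rewrite /cdist; case: pselect => [h|xy].
  case: ex_minnP => i xyi imin; apply: CdistDiff => // j ij.
  by apply/eqP; apply: contraTT ij => /imin; rewrite -leqNgt.
apply: CdistEq; apply/funext => i; apply/eqP; apply: contrapT => xyi.
by apply: xy; exists i; exact/negP.
Qed.

Lemma cdist_le x y j : (forall i, (i < j)%N -> x i = y i) -> cdist x y <= rad j.
Proof.
move=> xy; case: cdistP => [_|i _ xyi]; first exact/ltW/rad_gt0.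
by apply: rad_anti; rewrite leqNgt; apply/negP => /xy/eqP; rewrite (negbTE xyi).
Qed.

Lemma cdist_ge x y i : x i != y i -> rad i <= cdist x y.
Proof.
case: cdistP => [->|j xy xyj xyi]; first by rewrite eqxx.
by apply: rad_anti; rewrite leqNgt; apply/negP => /xy/eqP; rewrite (negbTE xyi).
Qed.

Lemma cdist_level x y r i : cdist x y <= r -> (i < level r)%N -> x i = y i.
Proof.
move=> xyr /lt_level ri; apply/eqP; apply: contraLR xyr => /cdist_ge xyi.
by rewrite -ltNge (lt_le_trans ri).
Qed.

Variables (T : Type) (c : T -> nat -> bool) (cinj : injective c).

Let cd (x y : T) := cdist (c x) (c y).

Fact cantor_distxx (x : T) : cd x x = 0.
Proof. by rewrite /cd; case: cdistP => // i _; rewrite eqxx. Qed.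

Fact cantor_dist_eq0 (x y : T) : cd x y = 0 -> x = y.
Proof.
by rewrite /cd; case: cdistP => [/cinj//|i _ _ /eqP]; rewrite gt_eqF// rad_gt0.
Qed.

Fact cantor_dist_sym (x y : T) : cd x y = cd y x.
Proof.
suff le (x' y' : T) : cd x' y' <= cd y' x' by apply/eqP; rewrite eq_le !le.
rewrite /cd; case: (cdistP (c x') (c y')) => [->|i _ xyi].
  by case: cdistP => // j _; rewrite eqxx.
by apply: cdist_ge; rewrite eq_sym.
Qed.

Fact cantor_dist_tri (y x z : T) : cd x z <= cd x y + cd y z.
Proof.
have cd0 (x' y' : T) : 0 <= cd x' y' by rewrite /cd; case: cdistP => // i _ _; exact/ltW/rad_gt0.
rewrite {1}/cd; case: cdistP => [_|i _ xzi]; first exact: addr_ge0.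
have [xyi|xyi] := eqVneq (c x i) (c y i).
  by apply: le_trans (_ : cd y z <= _); rewrite ?lerDr// cdist_ge// -xyi.
by apply: le_trans (_ : cd x y <= _); rewrite ?lerDl// cdist_ge.
Qed.

Fact cantor_dist_le1 (x y : T) : cd x y <= 1.
Proof. by rewrite /cd; case: cdistP => // i _ _; exact: rad_le1. Qed.

Definition cantor_mspace :=
  MSpace cantor_distxx cantor_dist_eq0 cantor_dist_sym cantor_dist_tri cantor_dist_le1.

End CantorDistance.

Section CantorSpaces.
Context {R : realType} (e : scale R).

Definition full_cantor : mspace R := cantor_mspace e (@inj_id (nat -> bool)).

Lemma nbhs_agree (x : cantor_space) n :
  nbhs x [set y : cantor_space | forall i, (i < n)%N -> x i = y i].
Proof.
have FF : Filter (nbhs x) by exact: nbhs_filter.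
elim: n => [|n IHn]; first by apply: filterS filterT => y _ i; rewrite ltn0.
have xn : nbhs x [set y : cantor_space | x n = y n].
  have := @proj_continuous nat (fun=> bool) n x.
  move=> /(_ [set b | x n = b]); apply.
  by rewrite (_ : [set b | x n = b] = [set x n]) ?discrete_set1//; apply/seteqP; split.
apply: filterS2 IHn xn => y xy xyn i.
by rewrite ltnS leq_eqVlt => /predU1P[->|/xy].
Qed.

Lemma compact_full_cantor : compact [set: metric_of full_cantor].
Proof.
pose f (x : cantor_space) : metric_of full_cantor := x.
have <- : f @` setT = setT by apply/seteqP; split => // x _; exists x.
apply: continuous_compact; last exact: cantor_space_compact.
apply: continuous_subspaceT => x; apply/cvg_ballP => r r0.
have [j rj] : exists j, rad e j < r.
  have [j rj] := rad_small e (divr_gt0 r0 (ltr0Sn R 1)); exists j.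
  by apply: le_lt_trans rj _; rewrite ltr_pdivrMr// ltr_pMr// ltr1n.
near=> y; rewrite ballEmdist /=; apply: le_lt_trans rj.
by apply: cdist_le; near: y; exact: nbhs_agree.
Unshelve. all: by end_near. Qed.

End CantorSpaces.

(** * The countable compact subset *)

Section Comb.
Context {R : realType} (e : scale R) (g : nat -> nat) (g_gt : forall j, (j < g j)%N).

(* If x j is the first nonzero coordinate then x vanishes from g j on. *)
Definition comb_set (x : nat -> bool) := forall i j, x i -> x j -> (i < g j)%N.

Definition comb := {x : nat -> bool | comb_set x}.

Lemma comb_inj : injective (fun x : comb => sval x).
Proof. by move=> x y /eq_sig_hprop_iff; apply => z a b; exact: Prop_irrelevance. Qed.

Definition comb_mspace : mspace R := cantor_mspace e comb_inj.

(** A retraction of the Cantor set onto the comb. Digit [i] of the result depends only on the digits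
    up to [i], so distances do not increase and compactness is inherited; later indices impose no
    condition since [j < g j]. *)
Definition truncate (x : nat -> bool) (i : nat) : bool :=
  x i && all (fun j => x j ==> (i < g j)%N) (iota 0 i.+1).

Lemma truncate_comb x : comb_set (truncate x).
Proof.
rewrite /truncate => i j /andP[xi /allP ai] /andP[xj _]; have [ij|ji] := ltnP i j.
  exact: ltn_trans (g_gt j).
by have := ai j; rewrite mem_iota /= ltnS ji xj; apply.
Qed.

Lemma truncate_id x : comb_set x -> truncate x = x.
Proof.
move=> xc; apply/funext => i; rewrite /truncate; case xi : (x i) => //; rewrite andTb.
by apply/allP => j _; apply/implyP => xj; exact: xc.
Qed.

Definition comb_of x : metric_of comb_mspace := exist _ (truncate x) (@truncate_comb x).

Lemma comb_ofK (x : metric_of comb_mspace) : comb_of (sval x) = x.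
Proof. by apply: comb_inj; exact: truncate_id (svalP x). Qed.

Lemma compact_comb : compact [set: metric_of comb_mspace].
Proof.
pose f (x : metric_of (full_cantor e)) : metric_of comb_mspace := comb_of x.
have <- : f @` setT = setT.
  by apply/seteqP; split => // x _; exists (sval x) => //; exact: comb_ofK.
apply: continuous_compact; last exact: compact_full_cantor.
apply: continuous_subspaceT; apply: continuous_isometry => x y.
rewrite !mdistE /=; case: (cdistP e x y) => [->|i xy _].
  by case: cdistP => // i _; rewrite eqxx.
apply: cdist_le => j ji; rewrite /truncate xy//; congr (_ && _).
have xyk k : k \in iota 0 j.+1 -> x k = y k.
  by rewrite mem_iota ltnS => /andP[_ kj]; rewrite xy// (leq_ltn_trans kj).
by apply/allP/allP => h k kj; have := h k kj; rewrite xyk.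
Qed.

(** Every element is a finite word padded with zeros, the default value of [nth]. *)
Lemma countable_comb : exists c : nat -> metric_of comb_mspace, range c = setT.
Proof.
exists (fun n => comb_of (nth false (odflt [::] (unpickle n : option (seq bool))))).
apply/seteqP; split => // x _.
suff [s sx] : exists s, nth false s = sval x.
  by exists (pickle s) => //; rewrite pickleK /= sx comb_ofK.
have [[j xj]|x0] := pselect (exists j, sval x j).
  exists (mkseq (sval x) (g j)); apply/funext => i.
  have [ij|ji] := ltnP i (g j); first by rewrite nth_mkseq.
  rewrite nth_default ?size_mkseq//; apply/esym/negP => xi.
  by have := svalP x i j xi xj; rewrite ltnNge ji.
exists [::]; apply/funext => i; rewrite nth_nil; apply/esym/negP => xi.
by apply: x0; exists i.
Qed.

End Comb.

(** * Finite cubes and the Hilbert cube in the supremum metric *)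

Record weights (R : realType) := Weights {
  wt :> nat -> R;
  wt_ge0 : forall i, 0 <= wt i;
  wt_le1 : forall i, wt i <= 1;
  wt_cvg0 : forall eps : R, 0 < eps -> exists n, forall i, (n <= i)%N -> wt i <= eps }.

Section Cube.
Context {R : realType} (w : weights R).

(** Sides 1 for the first [l] coordinates and 0 beyond give the finite cube; positive sides tending
    to 0 give the Hilbert cube. Because the sides tend to 0, the supremum distance is continuous for
    the product topology, and Tychonoff's theorem applies. *)
Definition cube := {x : nat -> R | forall i, 0 <= x i <= w i}.

Implicit Types x y : cube.

Definition cube_dist x y : R := sup (range (fun i => `|sval x i - sval y i|)).

Lemma cube_coord_le x y i : `|sval x i - sval y i| <= w i.
Proof.
have /andP[x0 xw] := svalP x i; have /andP[y0 yw] := svalP y i.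
by rewrite ler_norml; apply/andP; split; lra.
Qed.

Lemma cube_dist_ge x y i : `|sval x i - sval y i| <= cube_dist x y.
Proof.
apply: sup_ubound; last by exists i.
by exists 1 => _ [j _ <-]; exact: le_trans (cube_coord_le x y j) (wt_le1 w j).
Qed.

Lemma cube_dist_le x y r : (forall i, `|sval x i - sval y i| <= r) ->
  cube_dist x y <= r.
Proof.
by move=> xyr; apply: ge_sup; [exists `|sval x 0%N - sval y 0%N|; exists 0%N|move=> _ [i _ <-]].
Qed.

Fact cube_distxx x : cube_dist x x = 0.
Proof.
apply/eqP; rewrite eq_le; apply/andP; split.
  by apply: cube_dist_le => i; rewrite subrr normr0.
by apply: le_trans (cube_dist_ge x x 0%N); rewrite normr_ge0.
Qed.

Fact cube_dist_eq0 x y : cube_dist x y = 0 -> x = y.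
Proof.
move=> xy0; suff : sval x = sval y.
  by move=> /eq_sig_hprop_iff; apply => z a b; exact: Prop_irrelevance.
apply/funext => i; apply/eqP; rewrite -subr_eq0 -normr_le0.
by apply: le_trans (cube_dist_ge x y i) _; rewrite xy0.
Qed.

Fact cube_dist_sym x y : cube_dist x y = cube_dist y x.
Proof.
by congr sup; apply/seteqP; split => _ [i _ <-]; exists i => //; rewrite distrC.
Qed.

Fact cube_dist_tri y x z : cube_dist x z <= cube_dist x y + cube_dist y z.
Proof.
apply: cube_dist_le => i; apply: le_trans (ler_distD (sval y i) _ _) _.
by rewrite lerD// cube_dist_ge.
Qed.

Fact cube_dist_le1 x y : cube_dist x y <= 1.
Proof.
apply: cube_dist_le => i; exact: le_trans (cube_coord_le x y i) (wt_le1 w i).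
Qed.

Definition cube_mspace :=
  MSpace cube_distxx cube_dist_eq0 cube_dist_sym cube_dist_tri cube_dist_le1.

Definition clip (x : nat -> R) (i : nat) : R := Num.max 0 (Num.min (x i) (w i)).

Lemma clip_in (x : nat -> R) i : 0 <= clip x i <= w i.
Proof.
by rewrite /clip le_max lexx /= ge_max wt_ge0 /= ge_min lexx orbT.
Qed.

Definition cube_of (x : nat -> R) : metric_of cube_mspace := exist _ (clip x) (clip_in x).

Lemma clip_id (x : nat -> R) i : 0 <= x i <= w i -> clip x i = x i.
Proof. by move=> /andP[x0 xw]; rewrite /clip min_l// max_r. Qed.

Lemma cube_ofK (x : metric_of cube_mspace) : cube_of (sval x) = x.
Proof.
apply: cube_dist_eq0; apply/eqP; rewrite eq_le; apply/andP; split.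
  by apply: cube_dist_le => i /=; rewrite clip_id ?subrr ?normr0//; exact: (svalP x i).
by apply: le_trans (cube_dist_ge _ _ 0%N); rewrite normr_ge0.
Qed.

Lemma clip_dist (x y : nat -> R) i : `|clip x i - clip y i| <= `|x i - y i|.
Proof.
have max_dist (a b : R) : `|Num.max 0 a - Num.max 0 b| <= `|a - b|.
  have := ler_norm (a - b); have := ler_norm (b - a); rewrite (distrC b).
  move: `|a - b| => d ? ?; rewrite ler_norml.
  by case: (leP 0 a) => ?; case: (leP 0 b) => ?; apply/andP; split; lra.
apply: le_trans (max_dist _ _) _; move: (x i) (y i) (w i) => a b c.
have := ler_norm (a - b); have := ler_norm (b - a); rewrite (distrC b).
move: `|a - b| => d ? ?; rewrite ler_norml.
by case: (leP a c) => ?; case: (leP b c) => ?; apply/andP; split; lra.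
Qed.

Definition real_seq : topologicalType :=
  prod_topology (fun _ : nat => R : topologicalType).

Lemma nbhs_close (x : real_seq) r m : 0 < r ->
  nbhs x [set y : real_seq | forall i, (i < m)%N -> `|x i - y i| < r].
Proof.
move=> r0; have FF : Filter (nbhs x) by exact: nbhs_filter.
elim: m => [|m IHm]; first by apply: filterS filterT => y _ i; rewrite ltn0.
have xm : nbhs x [set y : real_seq | `|x m - y m| < r].
  have := @proj_continuous nat (fun=> R : topologicalType) m x.
  move=> /(_ [set z : R | `|x m - z| < r]); apply.
  exact: (nbhsx_ballx (x m : R) r r0).
apply: filterS2 IHm xm => y xy xym i.
by rewrite ltnS leq_eqVlt => /predU1P[->|/xy].
Qed.

Lemma continuous_cube_of : continuous (cube_of : real_seq -> metric_of cube_mspace).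
Proof.
move=> x; have FF : Filter (nbhs (x : real_seq)) by exact: nbhs_filter.
apply: (proj2 (@cvg_ballP _ (metric_of cube_mspace) _ _ FF cube_of (cube_of x))).
move=> r r0; have r2 : 0 < r / 2 by rewrite divr_gt0.
have [n nw] := wt_cvg0 w r2.
apply: filterS (nbhs_close x n r2) => y xy; rewrite ballEmdist /=.
apply: (@le_lt_trans _ _ (r / 2)); last by rewrite ltr_pdivrMr// ltr_pMr// ltr1n.
apply: cube_dist_le => i /=; have [ni|ni] := ltnP i n.
  by apply: le_trans (clip_dist _ _ _) _; exact/ltW/xy.
exact: le_trans (cube_coord_le (cube_of x) (cube_of y) i) (nw _ ni).
Qed.

Lemma compact_cube : compact [set: metric_of cube_mspace].
Proof.
pose A : set real_seq := [set x | forall i, x i \in `[0, w i]].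
have cA : compact A.
  have := @tychonoff nat (fun=> R) (fun i => [set` `[0, w i]]).
  by apply => i; exact: segment_compact.
have <- : (cube_of : real_seq -> metric_of cube_mspace) @` A = setT.
  apply/seteqP; split => // x _; exists (sval x); last exact: cube_ofK.
  by move=> i /=; rewrite in_itv /=; exact: (svalP x i).
apply: continuous_compact => //; apply: continuous_subspaceT.
exact: continuous_cube_of.
Qed.

End Cube.

(** * Covering dimension *)

Section CoveringDimension.
Context {R : realType}.
Implicit Types X : metricType R.

(** Covers by [k] finite families of disjoint open sets of small diameter. In family [c], the value
    0 marks the points left out and [m.+1] the member numbered [m], so disjointness is built in. *)
Definition mesh_le X (k : nat) := forall eps : R, 0 < eps ->
  exists (N : nat) (phi : 'I_k -> X -> nat),
  [/\ forall c x, (phi c x <= N)%N,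
      forall c m, open [set x | phi c x = m.+1],
      forall x, exists c, (0 < phi c x)%N &
      forall c x y, (0 < phi c x)%N -> phi c x = phi c y -> mdist x y < eps].

Lemma lebesgue_number X (C : set (set X)) : compact [set: X] ->
  C `<=` open -> \bigcup_(U in C) U = setT ->
  exists2 eps : R, 0 < eps & forall x, exists2 U, C U & ball x eps `<=` U.
Proof.
move=> cX Co CX.
have := cX; rewrite compact_near_coveringP => /(_ R (0^'+)
  (fun eps x => exists2 U, C U & ball x eps `<=` U) _).
case.
  move=> x _; have [U CU Ux] : (\bigcup_(U in C) U) x by rewrite CX.
  have := open_nbhs_nbhs (conj (Co _ CU) Ux).
  move=> /nbhs_ballP[d /= d0 dU].
  have d2 : 0 < d / 2 by rewrite divr_gt0.
  exists (ball x (d / 2), [set eps | eps < d / 2]) => /=.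
    by split; [exact: nbhsx_ballx|exact: nbhs_right_lt].
  move=> [y eps] /= [xy epsd]; exists U => // z yz; apply: dU.
  rewrite [d]splitr; apply: ball_triangle xy _.
  by apply: le_ball yz; exact: ltW.
move=> d /= d0 dP; exists (d / 2); first by rewrite divr_gt0.
move=> x; apply: (dP (d / 2)) => //=; last by rewrite divr_gt0.
by rewrite sub0r normrN gtr0_norm ?divr_gt0// ltr_pdivrMr// ltr_pMr// ltr1n.
Qed.

(** A point meets each of the [k] disjoint families at most once, and a mesh below a Lebesgue number
    makes the cover a refinement. *)
Lemma mesh_covering_mult X k : compact [set: X] -> mesh_le X k ->
  covering_mult_le X k.
Proof.
move=> cX Xk C _ Co CX; have [eps eps0 epsC] := lebesgue_number cX Co CX.
have [N [phi [phiN phio phiX phid]]] := Xk _ eps0.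
pose V (cm : 'I_k * 'I_N) : set X := [set x | phi cm.1 x = cm.2.+1].
(* Empty members are discarded, because the element of [C] around a member is found from one of its
   points. *)
exists [set W | W !=set0 /\ range V W]; split.
- apply: sub_finite_set (_ : finite_set (range V)); first by move=> W [].
  exact: finite_image.
- by move=> _ [_ [cm _ <-]]; exact: phio.
- apply/seteqP; split => // x _; have [c cx] := phiX x.
  have m_lt : ((phi c x).-1 < N)%N by rewrite prednK.
  have Vx : V (c, Ordinal m_lt) x by rewrite /V /= prednK.
  by exists (V (c, Ordinal m_lt)) => //; split; [exists x|exists (c, Ordinal m_lt)].
- move=> W [[x Wx] [cm _ VW]]; rewrite -{W}VW in Wx *.
  have [U CU xU] := epsC x; exists U => // y Vy; apply: xU; rewrite ballEmdist /=.
  by apply: (phid cm.1); rewrite ?Wx ?Vy.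
- move=> x; pose W (c : nat) : set X := [set y | exists2 c' : 'I_k, c' = c :> nat & phi c' y = phi c' x].
  apply: card_le_trans (card_image_le W `I_k); apply: subset_card_le.
  move=> _ [[_ [[c m] _ <-]] /= Vx]; exists (val c) => //=.
  apply/seteqP; split => y /=; last by rewrite /V /= -Vx => yx; exists c.
  by move=> [c' /val_inj ->]; rewrite /V /= => ->.
Qed.

Lemma dim_T_le X n : compact [set: X] -> mesh_le X n.+1 ->
  (dim_T R X <= n%:R%:E)%E.
Proof.
move=> cX Xn; apply: ereal_inf_lbound; exists n.+1; first exact: mesh_covering_mult.
by rewrite -[n.+1]addn1 natrD addrK.
Qed.

(** Here [q] places the unit cube in [X] and [p] extends its coordinates to [X]. In every direction
    each [U s] misses one of the two opposite faces. A refinement then labels the vertices of a fine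
    grid as Sperner's lemma requires, and [n.+1] vertices with distinct labels in one small simplex
    give [n.+1] members through one point. *)
Lemma covering_mult_gt X n (q : (nat -> R) -> X) (p : nat -> X -> R) k :
  compact [set: X] -> (forall i, continuous (p i)) ->
  (forall t i, (i < n)%N -> (forall j, 0 <= t j <= 1) -> p i (q t) = t i) ->
  (forall t t' r, 0 <= r -> (forall j, 0 <= t j <= 1) -> (forall j, 0 <= t' j <= 1) ->
     (forall j, `|t j - t' j| <= r) ->
     mdist (q t) (q t') <= r) ->
  covering_mult_le X k -> (n < k)%N.
Proof.
move=> cX pc pq qd Xk.
pose U (s : {set 'I_n}) : set X :=
  [set x | forall i : 'I_n, if i \in s then 0 < p i x else p i x < 1].
have Uo s : open (U s).
  rewrite openE => x Ux; apply: filter_forall => i; have := Ux i.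
  by case: (i \in s) => pix; [exact: cvgr_gt (pc i x) _ pix|exact: cvgr_lt (pc i x) _ pix].
have UX : \bigcup_(V in range U) V = setT.
  apply/seteqP; split => // x _; exists (U [set i : 'I_n | 0 < p i x]%SET).
    by exists [set i : 'I_n | 0 < p i x]%SET.
  by move=> i; rewrite inE; case: ltP => // /le_lt_trans; apply.
have [//||D [_ Do DX DU Dk]] := Xk _ _ _ UX.
- exact: finite_image.
- by move=> _ [s _ <-].
rewrite ltnNge; apply/negP => kn.
have [eps eps0 epsD] := lebesgue_number cX Do DX.
have [m' _ /(_ m' (leqnn m')) /= m'eps] := near_infty_natSinv_lt (PosNum eps0).
set m := m'.+1 in m'eps; have m0 : 0 < m%:R :> R by rewrite ltr0n.
pose t (a : nat -> nat) (j : nat) : R := if (j < n)%N then (a j)%:R / m%:R else 0.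
pose grid (a : nat -> nat) := forall i, (i < n)%N -> (a i <= m)%N.
have t01 a : grid a -> forall j, 0 <= t a j <= 1.
  move=> am j; rewrite /t; case: ifP => [/am aj|_]; last by rewrite lexx ler01.
  by rewrite divr_ge0//= ler_pdivrMr// mul1r ler_nat.
have /choice[V VP] (a : nat -> nat) : exists V, D V /\ ball (q (t a)) eps `<=` V.
  by have [V DV Va] := epsD (q (t a)); exists V.
have /choice[s sP] (W : set X) : exists s, D W -> W `<=` U s.
  have [DW|] := pselect (D W); last by exists finset.set0.
  by have [_ [s _ <-] Ws] := DU _ DW; exists s.
(* At a vertex with coordinate [i] equal to 0 the index [i] is not in the chosen set, so the label
   is at most [i]; where the coordinate is 1 it is in the set, so the label is not [i]. The label is
   [n] if no index is missing. *)
pose L W : nat := find (fun i => i \notin s W) (enum 'I_n).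
have pV a (i : 'I_n) : grid a ->
    if i \in s (V a) then 0 < (a i)%:R / m%:R :> R else (a i)%:R / m%:R < 1 :> R.
  move=> am; have [DV Va] := VP a.
  have : V a (q (t a)) by apply: Va; exact: ballxx.
  move=> /(sP _ DV) /(_ i); rewrite (pq _ _ (ltn_ord i) (t01 _ am)).
  by rewrite /t ltn_ord.
have Ln W : (L W <= n)%N by rewrite -[leqRHS](size_enum_ord n) find_size.
have [|a am _|v [vm v1 vL]] := @grid_sperner (L \o V) n m; first by [].
  split=> [|i ni]; first exact: Ln.
  have i_nth : nth (Ordinal ni) (enum 'I_n) i = Ordinal ni.
    by apply: val_inj; rewrite /= nth_enum_ord.
  have := pV a (Ordinal ni) am => /= pVi; split => [ai|ai].
    rewrite leqNgt; apply/negP => /(before_find (Ordinal ni)); rewrite i_nth.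
    by move=> /negbFE iV; move: pVi; rewrite iV ai mul0r ltxx.
  apply/eqP => Li; have : has (fun i => i \notin s (V a)) (enum 'I_n).
    by rewrite has_find size_enum_ord -/(L _) [X in (X < _)%N]Li.
  move=> /(nth_find (Ordinal ni)); rewrite -/(L _) [X in nth _ _ X]Li i_nth.
  by move=> /negbTE iV; move: pVi; rewrite iV ai mulfV ?gt_eqF// ltxx.
have tv k' : mdist (q (t (v k'))) (q (t (v 0%N))) < eps.
  apply: le_lt_trans m'eps; apply: qd; [by rewrite invr_ge0 ltW|exact: (t01 _ (vm _))|exact: (t01 _ (vm _))|].
  move=> j; rewrite /t; case: ifP => nj; last by rewrite subrr normr0 invr_ge0 ltW.
  rewrite -mulrBl normrM [X in _ * X]gtr0_norm ?invr_gt0// ler_piMl ?invr_ge0 ?(ltW m0)//.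
  have [] := v1 k' j; rewrite -!(ler_nat R) -natr1 => h1 h2.
  by rewrite ler_norml; apply/andP; split; lraR.
(* Each chosen member contains the [eps]-ball around its own vertex, hence the vertex [v 0]. *)
have := Dk (q (t (v 0%N))); set B := [set _ | _] => Bk.
have WB : (V \o v) @` `I_n.+1 `<=` B.
  move=> _ [k' _ <-]; have [DV Vv] := VP (v k'); split => //.
  by apply: Vv; rewrite ballEmdist /=.
have Wn : (V \o v) @` `I_n.+1 #= `I_n.+1.
  apply: inj_card_eq => i j; rewrite !inE /= => ni nj Vij.
  by apply: vL; rewrite ?ltnS//= Vij.
suff : (n.+1 <= k)%N by rewrite ltnNge kn.
rewrite -card_le_II -(card_le_eql Wn); apply: card_le_trans Bk.
exact: subset_card_le.
Qed.

End CoveringDimension.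

(** * Covers of disjoint sums and of Cantor sets *)

Section Mesh.
Context {R : realType}.

Lemma open_mdist (X : metricType R) (A : set X) :
  (forall x, A x -> exists2 r : R, 0 < r & forall y, mdist x y < r -> A y) -> open A.
Proof.
move=> h; rewrite openE => x /h[r r0 rA]; apply/nbhs_ballP; exists r => // y.
by rewrite ballEmdist => /rA.
Qed.

Lemma mdist_open (X : metricType R) (A : set X) x : open A -> A x ->
  exists2 r : R, 0 < r & forall y, mdist x y < r -> A y.
Proof.
rewrite openE => /(_ x) h /h /nbhs_ballP[r /= r0 rA]; exists r => // y xy.
by apply: rA; rewrite ballEmdist.
Qed.

(** The pieces lie at distance 1, so a family from each together form one disjoint open family, and
    the number of families does not grow. The shift by [n1] keeps the two numberings apart, while 0
    must stay 0. *)
Lemma mesh_sum (M N : mspace R) k : mesh_le (metric_of M) k ->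
  mesh_le (metric_of N) k -> mesh_le (metric_of (sum_mspace M N)) k.
Proof.
move=> Mk Nk eps eps0.
have [n1 [f1 [f1n f1o f1x f1d]]] := Mk _ eps0.
have [n2 [f2 [f2n f2o f2x f2d]]] := Nk _ eps0.
pose f (c : 'I_k) (x : metric_of (sum_mspace M N)) : nat :=
  match x with
  | inl x => f1 c x
  | inr y => if f2 c y == 0%N then 0%N else (n1 + f2 c y)%N
  end.
exists (n1 + n2)%N, f; split.
- move=> c [x|x] /=; first by rewrite (leq_trans (f1n c x))// leq_addr.
  by case: ifP => // _; rewrite leq_add2l.
- move=> c m; apply: open_mdist => -[x|x] /= fx.
    have [r r0 rP] := mdist_open (f1o c m) fx.
    exists (Num.min r 1); first by rewrite lt_min r0 ltr01.
    move=> [y|y]; rewrite mdistE /= lt_min => /andP[xy y1]; first exact: rP.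
    by rewrite ltxx in y1.
  have f2x0 : f2 c x != 0%N by case: eqP fx.
  rewrite (negbTE f2x0) in fx.
  have f2c : f2 c x = (f2 c x).-1.+1 by rewrite prednK// lt0n.
  have [r r0 rP] := mdist_open (f2o c (f2 c x).-1) f2c.
  exists (Num.min r 1); first by rewrite lt_min r0 ltr01.
  move=> [y|y]; rewrite mdistE /= lt_min => /andP[xy y1]; first by rewrite ltxx in y1.
  by rewrite (rP _ xy) -f2c (negbTE f2x0).
- move=> [x|x] /=; first exact: f1x.
  by have [c cx] := f2x x; exists c; rewrite /= -[X in if X then _ else _]negbK -lt0n cx /= ltn_addl.
- move=> c [x|x] [y|y] /=.
  + exact: f1d.
  + by move=> x0; case: eqP => [_ xy|]; [lia|have := f1n c x; lia].
  + by case: eqP => // x0 _; have := f1n c y; lia.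
  + by case: eqP => // x0 _; case: eqP => [|y0 /addnI]; [lia|apply: f2d; lia].
Qed.

Section Cantor.
Variables (e : scale R) (T : Type) (c : T -> nat -> bool) (cinj : injective c).
Local Notation X := (metric_of (cantor_mspace e cinj)).

(** The cylinders of one level already form an open partition; all [k] families are copies of it. *)
Lemma mesh_cantor k : (0 < k)%N -> mesh_le X k.
Proof.
move=> k0 eps eps0; have [j je] := rad_small e (divr_gt0 eps0 (ltr0Sn R 1)).
pose f (_ : 'I_k) (x : X) : nat :=
  (enum_rank [ffun i : 'I_j => c x i]).+1.
have fE i x y : f i x = f i y -> forall m, (m < j)%N -> c x m = c y m.
  move=> [/val_inj/enum_rank_inj/ffunP xy] m mj.
  by have := xy (Ordinal mj); rewrite !ffunE.
exists #|{ffun 'I_j -> bool}|, f; split.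
- by move=> i x; rewrite /f ltn_ord.
- move=> i m; apply: open_mdist => x fx; exists (rad e j); first exact: rad_gt0.
  move=> y xy; rewrite /= -fx; congr (_.+1); congr (nat_of_ord (enum_rank _)).
  apply/ffunP => a; rewrite !ffunE; apply/eqP; apply: contraTT xy => xya.
  rewrite -leNgt mdistE /=; apply: le_trans (_ : rad e a <= _).
    by apply: rad_anti; exact: ltnW.
  by apply: cdist_ge; rewrite eq_sym.
- by move=> x; exists (Ordinal k0).
- move=> i x y _ /fE xy; rewrite mdistE /=.
  apply: le_lt_trans (cdist_le e xy) _; apply: le_lt_trans je _.
  by rewrite ltr_pdivrMr// ltr_pMr// ltr1n.
Qed.

Lemma pcov_cantor (x : X) (r r' : R) : 0 < r -> r <= r' ->
  pcov (cball x r') r (2 ^ (level e r - level e r'))%N.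
Proof.
move=> r0 rr'; set i := level e r'; set j := level e r.
have -> : (2 ^ (j - i))%N = #|{ffun 'I_(j - i) -> bool}|.
  by rewrite card_ffun card_bool card_ord.
apply: (@pcov_fin _ _ _ (fun y : X => [ffun a : 'I_(j - i) => c y (i + a)%N])).
move=> y z xy xz /ffunP yz; apply: le_trans (rad_level e r0).
apply: cdist_le => a aj; have [ai|ia] := ltnP a i.
  by rewrite -(cdist_level (xy : cdist e (c x) (c y) <= r') ai)
       -(cdist_level (xz : cdist e (c x) (c z) <= r') ai).
have aij : (a - i < j - i)%N by rewrite ltn_sub2r// (leq_ltn_trans ia).
by have := yz (Ordinal aij); rewrite !ffunE /= subnKC.
Qed.

End Cantor.
End Mesh.

Lemma continuous_lip (R : realType) (X : metricType R) (f : X -> R) (K : R) :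
  0 <= K -> (forall x y, `|f x - f y| <= K * mdist x y) -> continuous f.
Proof.
move=> K0 fd x; apply/cvgrPdist_lt => eps eps0.
have K1 : 0 < K + 1 by rewrite ltr_wpDl.
apply/nbhs_ballP; exists (eps / (K + 1)); first exact: divr_gt0.
move=> y; rewrite ballEmdist /= => xy; apply: le_lt_trans (fd x y) _.
rewrite ltr_pdivlMr// in xy; apply: le_lt_trans xy.
by rewrite mulrC; apply: ler_wpM2l; rewrite ?mdist_ge0// lerDl.
Qed.

Lemma continuous_affine (R : realType) (X : metricType R) (f : X -> R) (a b : R) :
  continuous f -> continuous (fun x => a * f x + b).
Proof.
move=> fc x; apply: cvgD; last exact: cvg_cst.
by apply: cvgM; [exact: cvg_cst|exact: fc].
Qed.

Lemma open_box (R : realType) (X : metricType R) (I : finType) (f : I -> X -> R)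
    (a b : I -> R) : (forall i, continuous (f i)) ->
  open [set x | forall i, a i < f i x < b i].
Proof.
move=> fc; rewrite openE => x fx; apply: filter_forall => i.
have /andP[ax xb] := fx i; near=> y; apply/andP; split; near: y.
  exact: cvgr_gt (fc i x) _ ax.
exact: cvgr_lt (fc i x) _ xb.
Unshelve. all: by end_near. Qed.

(** * Grid covers of the cube *)

Section CubeCovers.
Context {R : realType} (w : weights R).
Local Notation Q := (metric_of (cube_mspace w)).

Lemma continuous_coord i : continuous (fun x : Q => sval x i : R).
Proof.
by apply: (continuous_lip ler01) => x y; rewrite mul1r; exact: cube_dist_ge.
Qed.

Variables (l : nat) (wl : forall i, (l <= i)%N -> wt w i = 0).

Lemma cube_coord0 (x : Q) i : (l <= i)%N -> sval x i = 0.
Proof. by move=> li; have := svalP x i; rewrite wl// -eq_le => /eqP. Qed.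

Lemma cube_dist_le_coord (x y : Q) (r : R) : 0 <= r ->
  (forall i, (i < l)%N -> `|sval x i - sval y i| <= r) -> mdist x y <= r.
Proof.
move=> r0 xy; rewrite mdistE; apply: cube_dist_le => i; have [/xy//|li] := ltnP i l.
by rewrite !cube_coord0// subrr normr0.
Qed.

(* The l + 1 translates by c / (l + 1) of the open unit cubes of a cubical grid
   cover: a coordinate is an integer for at most one c. *)
Lemma mesh_cube : mesh_le Q l.+1.
Proof.
move=> eps eps0.
have [M _ /(_ M (leqnn M)) /= Meps] := near_infty_natSinv_lt (PosNum eps0).
set m := M.+1%:R : R; rewrite -/m in Meps; have m0 : 0 < m by rewrite ltr0n.
have l0 : 0 < l.+1%:R :> R by rewrite ltr0n.
have lneq0 : l.+1%:R != 0 :> R by rewrite gt_eqF.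
pose v (c : 'I_l.+1) (x : Q) (i : nat) : R := m * sval x i + c%:R / l.+1%:R.
have v0 c x i : 0 <= v c x i.
  apply: addr_ge0; last by rewrite divr_ge0 ?ler0n.
  by apply: mulr_ge0; [exact: ltW|case/andP: (svalP x i)].
have vM c x i : v c x i < M.+2%:R.
  rewrite -natr1 -/m; apply: ler_ltD.
    apply: ler_piMr; first exact: ltW.
    by case/andP: (svalP x i) => _ xw; exact: le_trans xw (wt_le1 w i).
  by rewrite ltr_pdivrMr// mul1r ltr_nat ltn_ord.
have tM c x i : (Num.truncn (v c x i) < M.+2)%N.
  by rewrite truncn_lt_nat; [exact: vM|exact: v0].
pose code c x := [ffun i : 'I_l => Ordinal (tM c x i)].
pose good c x := [forall i : 'I_l, (Num.truncn (v c x i))%:R != v c x i].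
pose f c x : nat := if good c x then (enum_rank (code c x)).+1 else 0%N.
have fE c x y : (0 < f c x)%N -> f c x = f c y ->
    good c x /\ forall i, (i < l)%N -> Num.truncn (v c x i) = Num.truncn (v c y i).
  rewrite /f; case: ifP => // gx _; case: ifP => // gy [/val_inj/enum_rank_inj/ffunP xy].
  by split => // i il; have := xy (Ordinal il); rewrite !ffunE => -[].
have vt c x i := truncn_itv (v0 c x i).
exists #|{ffun 'I_l -> 'I_M.+2}|, f; split.
- by move=> c x; rewrite /f; case: ifP => // _; exact: ltn_ord.
- move=> c k; apply: open_mdist => x fx.
  have gx : good c x by move: fx; rewrite /= /f; case: ifP.
  have cont (i : 'I_l) : continuous (fun y => v c y i).
    exact: continuous_affine (@continuous_coord i).
  have box := open_box (fun i : 'I_l => (Num.truncn (v c x i))%:R)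
    (fun i : 'I_l => (Num.truncn (v c x i)).+1%:R) cont.
  have [|d d0 dP] := mdist_open (x := x) box.
    move=> i /=; have /andP[vx1 vx2] := vt c x i; rewrite vx2 andbT.
    by rewrite lt_neqAle vx1 andbT; exact: (forallP gx i).
  exists d => // y /dP /= xy.
  have tE (i : 'I_l) : Num.truncn (v c y i) = Num.truncn (v c x i).
    by apply: truncn_def; have /andP[vy1 ->] := xy i; rewrite (ltW vy1).
  rewrite -fx /= /f gx (_ : good c y); last first.
    by apply/forallP => i; rewrite tE; have /andP[+ _] := xy i; rewrite lt_neqAle => /andP[].
  congr (_.+1); congr (nat_of_ord (enum_rank _)).
  by apply/ffunP => i; rewrite !ffunE; apply: val_inj; exact: tE.
- move=> x; apply: contrapT => nx.
  have bad (c : 'I_l.+1) : exists i : 'I_l, (Num.truncn (v c x i))%:R = v c x i.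
    apply: contrapT => nc; apply: nx; exists c; rewrite /f; case: ifPn => //.
    by rewrite negb_forall => /existsP[i]; rewrite negbK => /eqP ci; case: nc; exists i.
  have /choice[i iP] := bad.
  have : injective i.
    move=> c c' cc'; apply/eqP; rewrite -val_eqE /=.
    have := iP c; have := iP c'; rewrite -cc' /v.
    move: (m * _) (Num.truncn _) (Num.truncn _) => a t' t tE tE'.
    have : (t * l.+1 + c = t' * l.+1 + c')%N.
      apply/eqP; rewrite -(eqr_nat R) !natrD !natrM tE tE' !mulrDl !divfK//.
      by apply/eqP; ring.
    move=> /(congr1 (modn^~ l.+1)); rewrite !modnMDl !modn_small ?ltn_ord// => ->.
    exact: eqxx.
  by move/leq_card; rewrite !card_ord ltnn.
- move=> c x y fx /(fE _ _ _ fx)[_ xy].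
  apply: le_lt_trans Meps; apply: cube_dist_le_coord => [|i il].
    by rewrite invr_ge0 ltW.
  rewrite -(ler_pM2l m0) mulfV ?gt_eqF// -[X in X * _](gtr0_norm m0) -normrM.
  have := vt c x i; have := vt c y i; rewrite (xy i il) -[X in _ < X]natr1 -[X in _ -> _ <= _ < X -> _]natr1 /v.
  move: (c%:R / _) (Num.truncn _)%:R => a b /andP[? ?] /andP[? ?].
  by rewrite mulrBr ler_norml; apply/andP; split; lraR.
Qed.

(** A ball of radius [r'] spans [2 r'] in each direction, hence at most [2 r' / r + 1 <= 3 r' / r]
    cells of side [r]. *)
Lemma pcov_cube (x : Q) (r r' : R) : 0 < r < r' ->
  exists2 n, pcov (cball x r') r n & n%:R <= (3 ^+ l) * (r' / r) ^+ l.
Proof.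
move=> /andP[r0 rr']; have r'0 : 0 < r' by apply: lt_trans rr'.
pose v (y : Q) i := (sval y i - sval x i + r') / r.
set m := (Num.truncn (2 * r' / r)).+1.
pose f (y : Q) : {ffun 'I_l -> 'I_m} := [ffun i : 'I_l => inord (Num.truncn (v y i))].
exists #|{ffun 'I_l -> 'I_m}|.
  apply: (pcov_fin (phi := f)) => y z xy xz /ffunP yz.
  have v_itv t i : cball x r' t -> 0 <= v t i <= 2 * r' / r.
    rewrite /cball /= => xt; have := le_trans (cube_dist_ge x t i) xt.
    rewrite ler_norml => /andP[h1 h2].
    by rewrite /v divr_ge0 ?(ltW r0)//= ?ler_pM2r ?invr_gt0//; lraR.
  have vt t i (xt : cball x r' t) := truncn_itv (proj1 (andP (v_itv t i xt))).
  apply: cube_dist_le_coord => [|i il]; first exact: ltW.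
  have := yz (Ordinal il); rewrite !ffunE /= => /(congr1 val) /=.
  have v_lt t : cball x r' t -> (Num.truncn (v t i) < m)%N.
    by move=> xt; rewrite ltnS le_truncn//; have /andP[] := v_itv t i xt.
  rewrite !inordK ?v_lt// => tyz.
  have := vt y i xy; have := vt z i xz; rewrite tyz -natr1.
  move: (Num.truncn _)%:R => b /andP[h1 h2] /andP[h3 h4].
  have -> : sval y i - sval z i = (v y i - v z i) * r.
    by rewrite /v -mulrBl divfK ?gt_eqF//; ring.
  rewrite normrM (gtr0_norm r0) ler_piMl ?(ltW r0)// ler_norml.
  by apply/andP; split; lraR.
rewrite card_ffun !card_ord natrX -exprMn.
have q1 : 1 <= r' / r by rewrite ler_pdivlMr// mul1r ltW.
apply: lerXn2r; rewrite ?nnegrE ?ler0n//.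
  by rewrite mulr_ge0 ?ler0n// (le_trans ler01).
rewrite /m; have : (Num.truncn (2 * r' / r))%:R <= 2 * r' / r.
  by rewrite truncn_le -mulrA mulr_ge0 ?ler0n// (le_trans ler01).
have -> : 2 * r' / r = 2 * (r' / r) by rewrite mulrA.
move=> trunc_le; rewrite -natr1; lraR.
Qed.

End CubeCovers.

(** * Scales of the Cantor sets *)

Section Scales.
Context {R : realType}.
Implicit Types (a b : \bar R) (s t : R).

Lemma natr_ge (x : R) : exists2 k : nat, (0 < k)%N & x <= k%:R.
Proof.
exists (Num.truncn x).+1 => //; exact/ltW/truncnS_gt.
Qed.

(** The common source of all scales below: slope [beta] inside the blocks that start at the [T k],
    and jumps [h k.+1 - h k] between them. *)
Lemma step_scale (beta : R) (h : nat -> R) (T : nat -> nat) :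
  0 <= beta -> h 0%N = 0 -> (forall k, h k <= h k.+1) ->
  T 0%N = 0%N -> (forall k, T k < T k.+1)%N ->
  (forall M : R, exists k, M <= beta * (T k)%:R + h k) ->
  exists e : scale R, (forall j, exists k, T k <= j < T k.+1)%N /\
    forall j k, (T k <= j < T k.+1)%N -> e j = beta * j%:R + h k.
Proof.
move=> beta0 h0 hmono T0 Tmono unb.
have Tle := homo_leq leqnn leq_trans (fun k => ltnW (Tmono k)).
have hle := homo_leq lexx le_trans hmono.
have Tge k : (k <= T k)%N by elim: k => // k IH; exact: leq_ltn_trans (Tmono k).
have T01 : (T 0 <= 0 < T 1)%N by have := Tmono 0%N; rewrite T0.
have kE j : exists k, (T k <= j < T k.+1)%N.
  elim: j => [|j [k /andP[k1 k2]]]; first by exists 0%N.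
  have [|jk] := ltnP j.+1 (T k.+1); first by exists k; rewrite (leq_trans k1).
  by exists k.+1; rewrite jk (leq_ltn_trans k2).
have /choice[kappa kP] := kE.
have kuniq j k : (T k <= j < T k.+1)%N -> kappa j = k.
  move=> /andP[k1 k2]; have /andP[k3 k4] := kP j; apply/eqP.
  rewrite eqn_leq; apply/andP; split; rewrite leqNgt; apply/negP => /Tle.
    by rewrite leqNgt (leq_ltn_trans k3 k2).
  by rewrite leqNgt (leq_ltn_trans k1 k4).
pose e j := beta * j%:R + h (kappa j).
have e0 : e 0%N = 0.
  by rewrite /e mulr0 add0r (kuniq 0%N 0%N).
have emono i j : (i <= j)%N -> e i <= e j.
  move=> ij; apply: lerD; first by rewrite ler_wpM2l// ler_nat.
  apply: hle; rewrite leqNgt; apply/negP => /Tle; rewrite leqNgt => /negP; apply.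
  have /andP[i1 _] := kP i; have /andP[_ j2] := kP j.
  exact: leq_ltn_trans (leq_trans i1 ij) j2.
have eunb M : exists j, M <= e j.
  have [k Mk] := unb M; exists (T k).
  by rewrite /e (kuniq _ k) ?leqnn ?Tmono.
exists (Scale e0 emono eunb); split => // j k jk.
by rewrite /= /e (kuniq _ _ jk).
Qed.

(** The scale for dimension 0, as [j / e j] tends to 0. *)
Lemma scale_sq : exists e : scale R, forall j, e j = j%:R ^+ 2.
Proof.
have [||||||e [_ eE]] := @step_scale 0 (fun k => k%:R ^+ 2) id => //.
- by rewrite expr0n.
- by move=> k; rewrite lerXn2r ?nnegrE ?ler0n// ler_nat.
- move=> M; have [k k0 Mk] := natr_ge M; exists k; rewrite mul0r add0r.
  by apply: le_trans Mk _; rewrite -natrX ler_nat leq_pmulr// -?expnS expn1.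
by exists e => j; rewrite (eE j j) ?leqnn ?ltnSn// mul0r add0r.
Qed.

Lemma sq_interval k : (k ^ 2 <= k ^ 2 < k.+1 ^ 2)%N.
Proof. by rewrite leqnn /= ltn_exp2r. Qed.

(** The integer part of the square root: the scale for infinite dimension. *)
Lemma scale_sqrt : exists e : scale R,
  (forall j, exists k, k ^ 2 <= j < k.+1 ^ 2)%N /\
  forall j k, (k ^ 2 <= j < k.+1 ^ 2)%N -> e j = k%:R.
Proof.
have [||||||e [ek eE]] := @step_scale 0 (fun k => k%:R) (fun k => k ^ 2)%N => //.
- by move=> k; rewrite ler_nat.
- by move=> k; rewrite ltn_exp2r.
- by move=> M; have [k k0 Mk] := natr_ge M; exists k; rewrite mul0r add0r.
by exists e; split => // j k /eE ->; rewrite mul0r add0r.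
Qed.

(** If [t (i + j) >= 1], factoring [j^2 - i^2] gives the bound; otherwise [j] itself is below
    [1 / t]. *)
Lemma scale_sq_increment (e : scale R) t : (forall j, e j = j%:R ^+ 2) -> 0 < t ->
  exists2 C : R, 0 <= C & forall i j, (i <= j)%N -> j%:R - i%:R <= t * (e j - e i) + C.
Proof.
move=> eE t0; exists t^-1; first by rewrite invr_ge0 ltW.
move=> i j; rewrite -(ler_nat R) !eE => ij; have : 0 <= i%:R :> R := ler0n _ _.
move: (i%:R : R) (j%:R : R) ij => x y xy x0.
have [tl|tl] := leP 1 (t * (x + y)).
  have -> : t * (y ^+ 2 - x ^+ 2) = (y - x) * (t * (x + y)) by ring.
  rewrite -[leLHS]addr0; apply: lerD; last by rewrite invr_ge0 ltW.
  by rewrite ler_peMr// subr_ge0.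
apply: (@le_trans _ _ t^-1); last first.
  rewrite lerDr; apply: mulr_ge0; first exact: ltW.
  by rewrite subr_ge0; apply: lerXn2r => //; rewrite nnegrE; exact: le_trans xy.
rewrite -[leRHS]mul1r ler_pdivlMr// mulrC; nra.
Qed.

(** Jumps only enlarge the increments of [e], which are therefore at least [beta (j - i)]. *)
Lemma increment_le (e : scale R) beta h (T : nat -> nat) t :
  (forall j, exists k, T k <= j < T k.+1)%N -> (forall k, T k < T k.+1)%N ->
  (forall k, h k <= h k.+1) ->
  (forall j k, (T k <= j < T k.+1)%N -> e j = beta * j%:R + h k) ->
  0 <= t -> 1 <= t * beta ->
  forall i j, (i <= j)%N -> j%:R - i%:R <= t * (e j - e i).
Proof.
move=> Tk Tmono hmono eE t0 tb i j ij.
have Tle := homo_leq leqnn leq_trans (fun k => ltnW (Tmono k)).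
have hle := homo_leq lexx le_trans hmono.
 have [k ik] := Tk i; have [k' jk'] := Tk j.
have kk' : (k <= k')%N.
  rewrite leqNgt; apply/negP => /Tle; case/andP: ik; case/andP: jk' => _ h1 h2 _ h3.
  by have := leq_ltn_trans h2 (leq_ltn_trans ij h1); rewrite ltnNge h3.
rewrite (eE _ _ ik) (eE _ _ jk').
have ji : i%:R <= j%:R :> R by rewrite ler_nat.
have := hle _ _ kk'; move: (h k) (h k') (i%:R : R) (j%:R : R) ji => u u' x y xy uu'.
apply: (@le_trans _ _ (t * beta * (y - x))); first by rewrite ler_peMl// subr_ge0.
rewrite -mulrA ler_wpM2l//; lra.
Qed.

(** The reciprocal of [a], equal to 0 at infinity, is described by inequalities so that finite and
    infinite [a] are treated alike. *)
Lemma ereal_recip a : (0 < a)%E -> exists beta : R,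
  [/\ 0 <= beta, forall s, 0 <= s -> (s%:E < a)%E -> s * beta < 1,
      forall t, (a < t%:E)%E -> 1 <= t * beta &
      forall A : R, 0 < A -> (A%:E <= a)%E -> beta <= A^-1].
Proof.
case: a => [a| |] // a0; last first.
  by exists 0; split => // [s _ _|A A0 _]; rewrite ?mulr0// invr_ge0 ltW.
rewrite lte_fin in a0; exists a^-1; split.
- by rewrite invr_ge0 ltW.
- by move=> s _; rewrite lte_fin ltr_pdivrMr// mul1r.
- by move=> t; rewrite lte_fin ler_pdivlMr// mul1r => /ltW.
- by move=> A A0; rewrite lee_fin => Aa; rewrite lef_pV2// posrE.
Qed.

(* In the main case e j = j / a2 + h k for T k <= j < T k.+1, where T grows so
   fast that j / e j oscillates between a1, at j = T k, and nearly a2, just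
   before the next jump. *)
Lemma scale_full a1 a2 : (0 <= a1)%E -> (a1 <= a2)%E -> exists e : scale R,
  [/\ forall s, 0 <= s -> (s%:E < a1)%E -> exists c : R, forall j, s * e j <= j%:R + c,
      forall s, 0 <= s -> (s%:E < a2)%E -> forall M : R, exists j, M <= j%:R - s * e j,
      forall s, 0 < s -> (a1 < s%:E)%E -> forall M : R, exists j, M <= s * e j - j%:R &
      forall t, 0 < t -> (a2 < t%:E)%E -> exists2 C : R, 0 <= C &
        forall i j, (i <= j)%N -> j%:R - i%:R <= t * (e j - e i) + C].
Proof.
move=> a10 a12; have [a20|a20] := eqVneq a2 0%E.
  have [e eE] := scale_sq; exists e; split.
  - by move=> s s0; rewrite ltNge (le_trans a12)// a20 lee_fin.
  - by move=> s s0; rewrite a20 lte_fin ltNge s0.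
  - move=> s s0 _ M; have [k k0 Mk] := natr_ge ((`|M| + 1) / s).
    exists k; rewrite eE; move: Mk; rewrite ler_pdivrMr//.
    have : 1 <= k%:R :> R by rewrite ler1n.
    have := ler_norm M; have := normr_ge0 M; move: `|M| (k%:R : R) => N x.
    clear a10 a12 a20 eE; nra.
  - by move=> t t0 _; exact: scale_sq_increment.
have [a1y|a1y] := eqVneq a1 +oo%E.
  move: a12; rewrite a1y leye_eq => /eqP a2y.
  have [e [ek eE]] := scale_sqrt; exists e.
  have sub s : 0 <= s -> forall M : R, exists j, M <= j%:R - s * e j.
    move=> s0 M; have [k k0 Mk] := natr_ge (`|M| + s + 1).
    exists (k ^ 2)%N; rewrite (eE _ _ (sq_interval k)) natrX; move: Mk.
    have : 1 <= k%:R :> R by rewrite ler1n.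
    have := ler_norm M; have := normr_ge0 M; move: `|M| (k%:R : R) => N x.
    clear a10 a2y a1y a20 eE; nra.
  split => //.
  - move=> s s0 _; exists (s ^+ 2) => j.
    have [k kj] := ek j; rewrite (eE j k kj); have /andP[k1 _] := kj; move: k1; rewrite -(ler_nat R) natrX.
    move: (k%:R : R) (j%:R : R) => x y; clear a10 a2y a1y a20 eE sub; nra.
  - by move=> s s0 _; exact: sub.
  - by move=> t t0; rewrite a2y.
have {}a20 : (0 < a2)%E by rewrite lt_neqAle eq_sym a20 (le_trans a10 a12).
have [beta [beta0 beta_lt beta_gt beta_le]] := ereal_recip a20.
case: a1 a10 a1y a12 => [A| |] // A0 _ Aa2; rewrite lee_fin in A0.
(* The factor [k] gives [T 0 = 0]. Consecutive terms grow by at least [k.+1 ^ 2], which beats the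
   jumps [g k], of order at most [k]. *)
pose T k := (k * k`! ^ 2)%N.
have TS k : (k.+1 ^ 2 * T k <= T k.+1)%N.
  rewrite /T factS expnMn mulnCA [X in (_ <= X)%N]mulnCA !mulnA leq_mul2r; lia.
have T0 : T 0%N = 0%N by [].
have Tgt0 k : (0 < k)%N -> (0 < T k)%N.
  by move=> k0; rewrite muln_gt0 k0 expn_gt0 fact_gt0.
have Tmono k : (T k < T k.+1)%N.
  have := TS k; case: k => [|k]; first by rewrite Tgt0.
  by have := Tgt0 k.+1 isT; nia.
have Tge k : (k <= T k)%N by rewrite leq_pmulr// expn_gt0 fact_gt0.
(* Since [e (T k)] is [(beta + g k)] times [T k], its quotient by [T k] is [1 / A], or tends to
   infinity when [A = 0]. *)
pose g k : R := if 0 < A then A^-1 - beta else k%:R.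
have g0 k : 0 <= g k.
  by rewrite /g; case: ifP => // A1; rewrite subr_ge0 beta_le.
have gS k : g k <= g k.+1 by rewrite /g; case: ifP; rewrite ?ler_nat.
(* As the inverse of 0 is 0, one bound serves both cases. *)
have gk k : g k <= A^-1 + k%:R.
  rewrite /g; case: ifP => _; last by rewrite lerDr invr_ge0.
  by have := ler0n R k; lraR.
have [||||||e [ek eE]] := @step_scale beta (fun k => g k * (T k)%:R) T => //.
- by rewrite mulr0.
- by move=> k; apply: ler_pM => //; rewrite ler_nat ltnW.
- move=> M; have [A1|A1] := ltP 0 A.
    have [k k0 Mk] := natr_ge (A * `|M|); exists k; rewrite /g A1 -mulrDl addrC subrK.
    rewrite ler_pdivlMl//; apply: (@le_trans _ _ (A * `|M|)); first by rewrite ler_wpM2l ?ler_norm.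
    by apply: le_trans Mk _; rewrite ler_nat.
  have [k k0 Mk] := natr_ge M; exists k; rewrite /g ltNge A1 /=.
  rewrite ler_wpDl ?mulr_ge0//; apply: le_trans Mk _; rewrite ler_peMr//.
  by rewrite ler1n Tgt0.
have gE k (A1 : 0 < A) : g k = A^-1 - beta by rewrite /g A1.
exists e; split.
- move=> s s0; rewrite lte_fin => sA; exists 0 => j; have [k kj] := ek j.
  have A1 : 0 < A by apply: le_lt_trans sA.
  rewrite addr0 (eE j k kj) gE//.
  have Tj : (T k)%:R <= j%:R :> R by rewrite ler_nat; case/andP: kj.
  apply: (@le_trans _ _ (s * (A^-1 * j%:R))).
    apply: ler_wpM2l => //; have : 0 <= A^-1 - beta by rewrite -(gE k A1).
    move: Tj; move: (T k)%:R j%:R => x y; clear; nra.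
  by rewrite mulrA ler_piMl// ler_pdivrMr// mul1r ltW.
- move=> s s0 sa2 M; have u0 := beta_lt s s0 sa2.
  pose u := 1 - s * beta; have up : 0 < u by rewrite subr_gt0.
  have [k k0 Mk] := natr_ge ((`|M| + 2 + s * (1 + A^-1)) / u).
  (* The last index of a block: the jump made at [T k] has become negligible and the next one has
     not yet occurred. *)
  exists (T k.+1).-1; rewrite (eE _ k); last first.
    by have := Tmono k; move: (T k.+1) (T k) => x y; lia.
  have -> : ((T k.+1).-1)%:R = (T k.+1)%:R - 1 :> R.
    by rewrite -[in RHS](prednK (Tgt0 k.+1 isT)) -natr1 addrK.
  have : (k%:R + 1) ^+ 2 * (T k)%:R <= (T k.+1)%:R :> R.
    by rewrite natr1 -natrX -natrM ler_nat.
  have : 1 <= (T k)%:R :> R by rewrite ler1n Tgt0.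
  have Ai : 0 <= A^-1 by rewrite invr_ge0.
  have K0 : 0 <= k%:R :> R by [].
  have K1 : 1 <= k%:R :> R by rewrite ler1n.
  move: Mk (gk k) (g0 k); rewrite ler_pdivrMr//.
  have := ler_norm M; have := normr_ge0 M.
  have u1 : u <= 1 by rewrite /u gerBl mulr_ge0.
  have ub : s * beta = 1 - u by rewrite /u; ring.
  move: ub K0 K1; move: (T k.+1)%:R (T k)%:R `|M| k%:R (g k) => T' x N K G ub K0 K1.
  move=> N0 MN Mk Gk G0 x1 xT'.
  have -> : T' - 1 - s * (beta * (T' - 1) + G * x) = u * (T' - 1) - s * G * x.
    have -> : T' - 1 - s * (beta * (T' - 1) + G * x) =
      T' - 1 - (s * beta) * (T' - 1) - s * G * x by ring.
    by rewrite ub; ring.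
  have h1 : u * ((K + 1) ^+ 2 * x - 1) <= u * (T' - 1).
    by apply: ler_wpM2l; [exact: ltW|rewrite lerD2r].
  have h2 : s * G * x <= s * ((1 + A^-1) * (K + 1)) * x.
    apply: ler_wpM2r; first exact: le_trans x1.
    apply: ler_wpM2l => //; apply: le_trans Gk _; nra.
  have h3 : (N + 2) * ((K + 1) * x) <= (u * (K + 1) - s * (1 + A^-1)) * ((K + 1) * x).
    apply: ler_wpM2r; first by rewrite mulr_ge0// ?addr_ge0// (le_trans _ x1).
    by move: Mk up; clear; nra.
  have h4 : N + 2 <= (N + 2) * ((K + 1) * x).
    apply: ler_peMr; first by rewrite addr_ge0.
    by move: K0 x1; clear; nra.
  have h5 : u * ((K + 1) ^+ 2 * x - 1) - s * ((1 + A^-1) * (K + 1)) * x =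
    (u * (K + 1) - s * (1 + A^-1)) * ((K + 1) * x) - u by ring.
  by move: MN N0 h1 h2 h3 h4 h5 u1; clear; lra.
- move=> s s0; rewrite lte_fin => As M.
  have jE k : e (T k) = (beta + g k) * (T k)%:R.
    by rewrite (eE _ k) ?leqnn ?Tmono// mulrDl.
  have [A1|A1] := ltP 0 A.
    have v0 : 0 < s / A - 1 by rewrite subr_gt0 ltr_pdivlMr// mul1r.
    have [k k0 Mk] := natr_ge (M / (s / A - 1)); exists (T k).
    rewrite jE gE// (addrC beta) subrK mulrA -[X in _ - X]mul1r -mulrBl mulrC.
    rewrite -ler_pdivrMr//; apply: le_trans Mk _; by rewrite ler_nat.
  have [k k0 Mk] := natr_ge ((`|M| + 1) / s); exists (T k).
  rewrite jE /g ltNge A1 /=; move: Mk; rewrite ler_pdivrMr//.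
  have := ler_norm M; have := normr_ge0 M.
  have : 1 <= (T k)%:R :> R by rewrite ler1n Tgt0.
  move: (T k)%:R k%:R `|M| => x K N x1 N0 MN Mk.
  have -> : s * ((beta + K) * x) - x = (s * beta + (K * s - 1)) * x by ring.
  have h : N <= s * beta + (K * s - 1).
    by have := mulr_ge0 (ltW s0) beta0; move: Mk; clear; lra.
  have : N * x <= (s * beta + (K * s - 1)) * x by apply: ler_wpM2r => //; exact: le_trans x1.
  apply: le_trans; apply: le_trans MN _; exact: ler_peMr.
- move=> t t0 a2t; exists 0 => // i j ij; rewrite addr0.
  apply: (increment_le ek Tmono _ eE) => //; [|exact: ltW|exact: beta_gt].
  by move=> k; apply: ler_pM => //; rewrite ler_nat ltnW.
Qed.

(* Same shape with T k = k ^ 2: the slope of j against e is a4 inside the blocks,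
   whose lengths are unbounded but o(j), and a3 on average. *)
Lemma scale_comb a3 a4 : (0 <= a3)%E -> (a3 <= a4)%E -> exists e : scale R,
  [/\ forall s, 0 < s -> (a3 < s%:E)%E -> exists2 C : R, 0 <= C &
        forall j, j%:R <= s * e j + C,
      forall s, 0 <= s -> (s%:E < a3)%E -> forall M : R,
        exists i j, (i <= j <= i.+1 ^ 2)%N /\ M <= j%:R - i%:R - s * e j,
      forall s, 0 <= s -> (s%:E < a4)%E -> forall M : R,
        exists i j, (i <= j <= i.+1 ^ 2)%N /\ M <= j%:R - i%:R - s * (e j - e i) &
      forall t, 0 < t -> (a4 < t%:E)%E -> exists2 C : R, 0 <= C &
        forall i j, (i <= j)%N -> j%:R - i%:R <= t * (e j - e i) + C].
Proof.
move=> a30 a34; have [a40|a40] := eqVneq a4 0%E.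
  have [e eE] := scale_sq; exists e; split.
  - move=> s s0 _; have [C C0 CP] := scale_sq_increment eE s0; exists C => // j.
    by have := CP 0%N j isT; rewrite (sc0 e) !subr0.
  - by move=> s s0; rewrite ltNge (le_trans a34)// a40 lee_fin.
  - by move=> s s0; rewrite a40 lte_fin ltNge s0.
  - by move=> t t0 _; exact: scale_sq_increment.
have [a3y|a3y] := eqVneq a3 +oo%E.
  move: a34; rewrite a3y leye_eq => /eqP a4y.
  have [e [ek eE]] := scale_sqrt; exists e.
  have sub s : 0 <= s -> forall M : R,
      exists i j, (i <= j <= i.+1 ^ 2)%N /\ M <= j%:R - i%:R - s * e j.
    move=> s0 M; have [k k0 Mk] := natr_ge (`|M| + s + 2).
    exists k, (k ^ 2)%N; split.
      by rewrite -{1}[k]expn1 leq_pexp2l//= leq_exp2r.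
    rewrite (eE _ _ (sq_interval k)) natrX; move: Mk.
    have := ler_norm M; have := normr_ge0 M; move: `|M| (k%:R : R) => N x.
    move: s0; clear; nra.
  split => //.
  - by move=> s s0 _; exact: sub.
  - move=> s s0 _ M; have [i [j [ij Mij]]] := sub s s0 M; exists i, j; split => //.
    apply: le_trans Mij _; rewrite lerD2l lerN2 ler_wpM2l// gerBl.
    by rewrite -(sc0 e) sc_mono.
  - by move=> t t0; rewrite a4y.
have {}a40 : (0 < a4)%E by rewrite lt_neqAle eq_sym a40 (le_trans a30 a34).
have [beta [beta0 beta_lt beta_gt beta_le]] := ereal_recip a40.
case: a3 a30 a3y a34 => [A| |] // A0 _ Aa4; rewrite lee_fin in A0.
pose T k := (k ^ 2)%N.
have Tmono k : (T k < T k.+1)%N by rewrite ltn_exp2r.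
(* Then [e (k ^ 2)] is exactly [k ^ 2 / A]; for [A = 0] the cube of [k] outgrows the index
   [k ^ 2]. *)
pose h k : R := if 0 < A then (A^-1 - beta) * k%:R ^+ 2 else k%:R ^+ 3.
have hS k : h k <= h k.+1.
  rewrite /h; case: ifP => A1.
    apply: ler_wpM2l; first by rewrite subr_ge0 beta_le.
    by apply: lerXn2r; rewrite ?nnegrE ?ler_nat.
  by apply: lerXn2r; rewrite ?nnegrE ?ler_nat.
have h0 : h 0%N = 0 by rewrite /h; case: ifP; rewrite ?expr0n ?mulr0.
have [||||||e [ek eE]] := @step_scale beta h T => //.
  move=> M; have [A1|A1] := ltP 0 A.
    have [k k0 Mk] := natr_ge (A * `|M|); exists k.
    rewrite /h A1 natrX -mulrDl addrC subrK ler_pdivlMl//.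
    apply: (@le_trans _ _ (A * `|M|)); first by rewrite ler_wpM2l ?ler_norm.
    by apply: le_trans Mk _; rewrite expr2 ler_peMr// ler1n.
  have [k k0 Mk] := natr_ge M; exists k; rewrite /h ltNge A1 /=.
  rewrite ler_wpDl ?mulr_ge0//; apply: le_trans Mk _.
  by rewrite exprS ler_peMr// exprn_ege1// ler1n.
have hE (A1 : 0 < A) k : h k = (A^-1 - beta) * k%:R ^+ 2 by rewrite /h A1.
have eT k : e (T k) = beta * k%:R ^+ 2 + h k.
  by rewrite (eE _ k) ?leqnn ?Tmono// natrX.
exists e; split.
- move=> s s0; rewrite lte_fin => As; have [A1|A1] := ltP 0 A.
    have v0 : 0 < s / A - 1 by rewrite subr_gt0 ltr_pdivlMr// mul1r.
    (* With [w = s / A] and [z = 1 / (w - 1)], the bound [k^2 + 2 k <= w k^2 + z] says that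
       [(w - 1) (k - z)^2] is nonnegative. *)
    exists (s / A - 1)^-1; first by rewrite invr_ge0 ltW.
    move=> j; have [k kj] := ek j; case/andP: (kj) => kj1 kj2.
    apply: (@le_trans _ _ (s * e (T k) + (s / A - 1)^-1)); last first.
      by rewrite lerD2r; apply: ler_wpM2l; [exact: ltW|exact: sc_mono].
    rewrite eT hE// -mulrDl (addrC beta) subrK mulrA.
    have : j%:R <= k%:R ^+ 2 + 2 * k%:R :> R.
      rewrite -natrX -natrM -natrD ler_nat; move: kj2; rewrite /T; lia.
    move: v0; move: (s / A) (k%:R : R) (j%:R : R) => w x y w0.
    set z := (w - 1)^-1; have wz : (w - 1) * z = 1 by rewrite mulfV// gt_eqF.
    have z0 : 0 < z by rewrite invr_gt0.
    have : 0 <= (w - 1) * (x - z) ^+ 2 by rewrite mulr_ge0 ?sqr_ge0// ltW.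
    have -> : (w - 1) * (x - z) ^+ 2 =
      (w - 1) * x ^+ 2 - 2 * ((w - 1) * z) * x + ((w - 1) * z) * z by ring.
    rewrite wz; clear; lra.
  (* Here [j <= 3 k^2] and [s e j >= s k^3]. Either [s k >= 3] and the second dominates, or
     [3 k^2 < 27 / s^2]. *)
  exists (27 / s ^+ 2); first by rewrite divr_ge0 ?exprn_ge0 ?ltW.
  move=> j; have [k kj] := ek j; case/andP: (kj) => kj1 kj2.
  apply: (@le_trans _ _ (s * e (T k) + 27 / s ^+ 2)); last first.
    by rewrite lerD2r; apply: ler_wpM2l; [exact: ltW|exact: sc_mono].
  rewrite eT /h ltNge A1 /=.
  have : j%:R <= 3 * k%:R ^+ 2 :> R.
    rewrite -natrX -natrM ler_nat; move: kj2; rewrite /T; case: k {kj kj1} => [|k]; lia.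
  have : 0 <= k%:R :> R by [].
  move: (k%:R : R) (j%:R : R) => x y x0 yx; apply: le_trans yx _.
  apply: (@le_trans _ _ (s * x ^+ 3 + 27 / s ^+ 2)); last first.
    rewrite lerD2r; apply: ler_wpM2l; first exact: ltW.
    by rewrite ler_wpDl// mulr_ge0 ?exprn_ge0.
  have [sx|sx] := leP 3 (s * x).
    apply: (@le_trans _ _ (s * x ^+ 3)); last first.
      by rewrite lerDl divr_ge0 ?exprn_ge0 ?ltW.
    by rewrite [in leRHS]exprS mulrA ler_wpM2r ?exprn_ge0.
  apply: (@le_trans _ _ (27 / s ^+ 2)); last first.
    by rewrite lerDr; apply: mulr_ge0; [exact: ltW|exact: exprn_ge0].
  rewrite ler_pdivlMr ?exprn_gt0// -mulrA -exprMn (mulrC x).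
  have : 0 <= s * x by apply: mulr_ge0 => //; exact: ltW.
  by move: sx; move: (s * x) => z; clear; nra.
- move=> s s0; rewrite lte_fin => sA M.
  have A1 : 0 < A by apply: le_lt_trans sA.
  have u0 : 0 < 1 - s / A by rewrite subr_gt0 ltr_pdivrMr// mul1r.
  (* Losing the first [k] digits does not matter against a surplus of order [k ^ 2]. *)
  have [k k0 Mk] := natr_ge ((`|M| + 2) / (1 - s / A)); exists k, (k ^ 2)%N; split.
    by rewrite -{1}[k]expn1 leq_pexp2l//= leq_exp2r.
  rewrite eT hE// -mulrDl (addrC beta) subrK mulrA natrX.
  move: Mk; rewrite ler_pdivrMr//; have : 1 <= k%:R :> R by rewrite ler1n.
  have := ler_norm M; have := normr_ge0 M; move: u0.
  by move: (s / A) (k%:R : R) `|M| => u x N; clear; nra.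
- move=> s s0 sa M; have u0 := beta_lt s s0 sa.
  have {}u0 : 0 < 1 - s * beta by rewrite subr_gt0.
  have [k k0 Mk] := natr_ge (M / (1 - s * beta)).
  (* The first and last index of one block, where only the slope [beta] acts; the surplus is
     [2 k (1 - s beta)]. *)
  exists (k ^ 2)%N, (k ^ 2 + 2 * k)%N; split.
    by rewrite leq_addr /=; nia.
  rewrite (eE _ k); last by rewrite /T; lia.
  rewrite eT natrD (natrM _ 2 k) !natrX; move: Mk; rewrite ler_pdivrMr//.
  have : 0 <= k%:R :> R by []; move: u0.
  move: (h k) (k%:R : R) => H x u0 x0 Mx.
  have -> : x ^+ 2 + 2 * x - x ^+ 2 -
    s * (beta * (x ^+ 2 + 2 * x) + H - (beta * x ^+ 2 + H)) =
    2 * (x * (1 - s * beta)) by ring.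
  have : 0 <= x * (1 - s * beta) by apply: mulr_ge0 => //; exact: ltW.
  by move: Mx; clear; lra.
- move=> t t0 a4t; exists 0 => // i j ij; rewrite addr0.
  by apply: (increment_le ek Tmono hS eE) => //; [exact: ltW|exact: beta_gt].
Qed.

End Scales.

(** * Bounds for the building blocks *)

Lemma powR_ge1 (R : realType) (a x : R) : 1 <= a -> 0 <= x -> 1 <= a `^ x.
Proof. by move=> a1 x0; rewrite -[leLHS](powRr0 a); exact: ler_powR. Qed.

Lemma powRD2 (R : realType) (x y : R) : 2 `^ (x + y) = 2 `^ x * 2 `^ y.
Proof. by rewrite powRD// pnatr_eq0 implybT. Qed.

Lemma powR2_nat (R : realType) n : (2 ^ n)%:R = 2 `^ n%:R :> R.
Proof. by rewrite natrX powR_mulrn. Qed.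

Lemma ler_powR2 (R : realType) (x y : R) : x <= y -> 2 `^ x <= 2 `^ y.
Proof. by apply: ler_powR; rewrite ler1n. Qed.

Section SumBounds.
Context {R : realType}.
Implicit Types (M N : mspace R) (s t r : R).

Definition assouad_bound (X : metricType R) s (C : R) := forall (x : X) r r', 0 < r < r' ->
  exists2 n, pcov (cball x r') r n & n%:R <= C * (r' / r) `^ s.

Definition box_bound (X : metricType R) (A : set X) s (C : R) := forall r, 0 < r <= 1 ->
  exists2 n, pcov A r n & n%:R <= C * r `^ (- s).

Lemma pcov_image M (X : metricType R) (f : metric_of M -> X) (S : set (metric_of M)) r n :
  (forall x y, mdist (f x) (f y) = mdist x y) -> pcov S r n -> pcov (f @` S) r n.
Proof.
move=> fd [phi [phin phir]].
have finj x y : f x = f y -> x = y.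
  by move=> fxy; apply: (@mdist_positivity R); rewrite -fd fxy mdistxx.
pose psi y : nat := if pselect (exists2 x, S x & f x = y) is left h
  then phi (projT1 (cid2 h)) else 0%N.
have psiE x : S x -> psi (f x) = phi x.
  move=> Sx; rewrite /psi; case: pselect => [h|[]]; last by exists x.
  by case: (cid2 h) => x' /= _ /finj ->.
exists psi; split => [_ [x Sx <-]|_ _ [x Sx <-] [y Sy <-]]; first by rewrite psiE ?phin.
by rewrite !psiE// fd; exact: phir.
Qed.

(** A ball reaches the other piece only if its radius is at least 1, and then any ball of that
    radius there is the whole piece; so [m0] and [n0] can be arbitrary. *)
Lemma assouad_sum M N (m0 : metric_of M) (n0 : metric_of N) s (C D : R) :
  assouad_bound (metric_of M) s C -> assouad_bound (metric_of N) s D ->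
  assouad_bound (metric_of (sum_mspace M N)) s (C + D).
Proof.
move=> MC ND x r r' rr'.
pose i1 (x : metric_of M) : metric_of (sum_mspace M N) := inl x.
pose i2 (x : metric_of N) : metric_of (sum_mspace M N) := inr x.
suff [m [n xmn]] : exists m n, cball x r' `<=` i1 @` cball m r' `|` i2 @` cball n r'.
  have [k1 c1 k1C] := MC m r r' rr'; have [k2 c2 k2D] := ND n r r' rr'.
  exists (k1 + k2)%N; last by rewrite natrD mulrDl lerD.
  by apply: (sub_pcov xmn); apply: pcovU; exact: pcov_image.
case: x => [m|n].
  exists m, n0 => -[y|y]; rewrite /cball /= mdistE /= => xy; [left|right]; exists y => //.
  by rewrite /= (le_trans (mdist_le1 _ _)).
exists m0, n => -[y|y]; rewrite /cball /= mdistE /= => xy; [left|right]; exists y => //.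
by rewrite /= (le_trans (mdist_le1 _ _)).
Qed.

Lemma box_boundU (X : metricType R) (A B : set X) s (C D : R) : box_bound A s C ->
  box_bound B s D -> box_bound (A `|` B) s (C + D).
Proof.
move=> AC BD r r01; have [k1 c1 k1C] := AC r r01; have [k2 c2 k2D] := BD r r01.
by exists (k1 + k2)%N; [exact: pcovU|rewrite natrD mulrDl lerD].
Qed.

Lemma box_bound_image M (X : metricType R) (f : metric_of M -> X) s (C : R) :
  (forall x y, mdist (f x) (f y) = mdist x y) ->
  box_bound [set: metric_of M] s C -> box_bound (range f) s C.
Proof.
by move=> fd MC r /MC[n c nC]; exists n => //; exact: pcov_image.
Qed.

Lemma assouad_box M (m0 : metric_of M) s (C : R) : assouad_bound (metric_of M) s C ->
  box_bound [set: metric_of M] s (C * 2 `^ s).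
Proof.
(* Radius 2 rather than 1, since [r = 1] is allowed and the outer radius must be larger. *)
move=> MC r /andP[r0 r1]; have [|n c nC] := MC m0 r 2.
  by rewrite r0 (le_lt_trans r1)// ltr1n.
exists n; first by apply: sub_pcov c => y _; rewrite /cball /= (le_trans (mdist_le1 _ _))// ler1n.
apply: le_trans nC _; rewrite powRM ?invr_ge0 ?(ltW r0)//.
by rewrite -powR_inv1 ?(ltW r0)// -powRrM mulN1r mulrA.
Qed.

(** The radius just before [level r] still exceeds [r], so [r' / r] dominates the ratio of the radii
    at [level r'] and there; this step back by one turns [C] into [C + 1]. The hypothesis fixes one
    end at [level r'], so that [r' = 1] gives the box bound. *)
Lemma level_count (e : scale R) t (C : R) r r' : 0 <= t -> 0 <= C -> 0 < r -> r <= r' ->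
  (forall j, (level e r' <= j)%N ->
    j%:R - (level e r')%:R <= t * (e j - e (level e r')) + C) ->
  (2 ^ (level e r - level e r'))%:R <= 2 `^ (C + 1) * (r' / r) `^ t.
Proof.
move=> t0 C0 r0 rr' eC; set i := level e r'; set j := level e r.
have r'0 : 0 < r' by apply: lt_le_trans rr'.
have q1 : 1 <= r' / r by rewrite ler_pdivlMr// mul1r.
have C1 : 1 <= 2 `^ (C + 1) by rewrite powR_ge1 ?ler1n ?addr_ge0.
have qt1 : 1 <= (r' / r) `^ t by exact: powR_ge1.
have [ji|ij] := leqP j i.
  by rewrite (eqP ji) expn0 -[leLHS]mulr1 ler_pM.
have jE : j = j.-1.+1 by rewrite prednK// (leq_ltn_trans _ ij).
have ij1 : (i <= j.-1)%N by rewrite -ltnS -jE.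
have rj : r < rad e j.-1 by apply: lt_level; rewrite -/j {2}jE.
have ri : rad e i <= r' by exact: rad_level.
have q_ge : 2 `^ (e j.-1 - e i) <= r' / r.
  rewrite ler_pdivlMr//; apply: le_trans ri.
  apply: (@le_trans _ _ (2 `^ (e j.-1 - e i) * rad e j.-1)).
    by rewrite ler_wpM2l ?powR_ge0// ltW.
  by rewrite /rad -powRD2 addrAC subrr add0r.
have qt_ge : 2 `^ (j.-1%:R - i%:R - C) <= (r' / r) `^ t.
  apply: (@le_trans _ _ ((2 `^ (e j.-1 - e i)) `^ t)); last first.
    by apply: ge0_ler_powR => //; rewrite nnegrE ?powR_ge0// (le_trans ler01).
  rewrite -powRrM; apply: ler_powR2; rewrite mulrC lerBlDr; exact: eC.
have -> : (2 ^ (j - i))%:R = 2 `^ (C + 1) * 2 `^ (j.-1%:R - i%:R - C) :> R.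
  rewrite -powRD2 powR2_nat; congr (_ `^ _).
  by rewrite natrB ?(ltnW ij)// {1}jE -natr1; ring.
by rewrite ler_wpM2l ?powR_ge0.
Qed.

Lemma sep_fin (X : metricType R) (I : finType) (psi : I -> X) (S : set X) r : (0 < #|I|)%N ->
  (forall i, S (psi i)) -> (forall i j, i != j -> 2 * r < mdist (psi i) (psi j)) ->
  sep S r #|I|.
Proof.
move=> /card_gt0P[i0 _] Spsi dpsi.
exists (fun k => psi (nth i0 (enum I) k)); split => // i j /andP[ij jn].
apply: dpsi; rewrite nth_uniq ?enum_uniq -?cardE ?(ltn_trans ij)//.
by rewrite ltn_eqF.
Qed.

End SumBounds.

Section SpaceBounds.
Context {R : realType}.
Implicit Types (s t r : R).

Lemma cube_assouad (w : weights R) l s : (forall i, (l <= i)%N -> wt w i = 0) ->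
  l%:R <= s -> assouad_bound (metric_of (cube_mspace w)) s (3 ^+ l).
Proof.
move=> wl ls x r r' rr'; have [n c nC] := pcov_cube wl x rr'; exists n => //.
have /andP[r0 r0'] := rr'.
apply: le_trans nC _; rewrite ler_wpM2l ?exprn_ge0// -powR_mulrn; last first.
  by rewrite divr_ge0 ?(ltW r0)// (le_trans (ltW r0))// ltW.
by apply: ler_powR; rewrite ?ler_pdivlMr// mul1r ltW.
Qed.

Section Cantor.
Variables (e : scale R) (T : Type) (c : T -> nat -> bool) (cinj : injective c).
Local Notation X := (metric_of (cantor_mspace e cinj)).

Lemma level1 : level e 1 = 0%N.
Proof.
by apply/eqP; rewrite -leqn0 leqNgt; apply/negP => /lt_level; rewrite rad0 ltxx.
Qed.

Lemma cantor_assouad t (C : R) : 0 <= t -> 0 <= C ->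
  (forall i j, (i <= j)%N -> j%:R - i%:R <= t * (e j - e i) + C) ->
  assouad_bound X t (2 `^ (C + 1)).
Proof.
move=> t0 C0 eC x r r' /andP[r0 rr'].
exists (2 ^ (level e r - level e r'))%N; first by apply: pcov_cantor => //; exact: ltW.
by apply: level_count => //; [exact: ltW|move=> j; exact: eC].
Qed.

Lemma pcov_cantorT r : 0 < r -> pcov [set: X] r (2 ^ level e r)%N.
Proof.
move=> r0; have [[x1 _]|x0] := pselect (exists x : X, True); last first.
  exists (fun=> 0%N); split => [x|x]; first by case: x0; exists x.
  by case: x0; exists x.
have r1 : r <= Num.max r 1 by rewrite le_max lexx.
have m1 : 1 <= Num.max r 1 by rewrite le_max lexx orbT.
have := pcov_cantor (cinj := cinj) x1 r0 r1; have -> : level e (Num.max r 1) = 0%N.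
  by apply/eqP; rewrite -leqn0 -level1 level_anti.
rewrite subn0; apply: sub_pcov => y _; rewrite /cball /=.
exact: le_trans (mdist_le1 _ _) m1.
Qed.

Lemma cantor_box s (C : R) : 0 <= s -> 0 <= C ->
  (forall j, j%:R <= s * e j + C) -> box_bound [set: X] s (2 `^ (C + 1)).
Proof.
move=> s0 C0 eC r /andP[r0 r1]; exists (2 ^ level e r)%N; first exact: pcov_cantorT.
have := @level_count _ e s C r 1 s0 C0 r0 r1; rewrite level1 subn0.
rewrite div1r -powR_inv1 ?(ltW r0)// -powRrM mulN1r; apply => j _.
by rewrite sc0 !subr0.
Qed.

Lemma pcov_rad j : exists2 n, pcov [set: X] (rad e j) n & (n <= 2 ^ j)%N.
Proof.
exists (2 ^ level e (rad e j))%N; first exact/pcov_cantorT/rad_gt0.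
by rewrite leq_exp2l// leqNgt; apply/negP => /lt_level; rewrite ltxx.
Qed.

End Cantor.

Lemma rad_quarter (e : scale R) j : 2 * (rad e j / 4) < rad e j.
Proof. by have := rad_gt0 e j; lra. Qed.

(** Words that differ before [j] are at least [rad e j] apart; a quarter of this makes the
    separation strict. As [code] is defined on any space, a piece can be read inside the union. *)
Lemma sep_words (X : metricType R) (e : scale R) (S : set X) (i j : nat)
    (psi : {ffun 'I_(j - i) -> bool} -> X) (code : X -> nat -> bool) :
  (forall x y a, code x a != code y a -> rad e a <= mdist x y) ->
  (forall v, S (psi v)) ->
  (forall v (a : 'I_(j - i)), code (psi v) (i + a)%N = v a) ->
  sep S (rad e j / 4) (2 ^ (j - i))%N.
Proof.
move=> codeP Spsi psiE.
have -> : (2 ^ (j - i))%N = #|{ffun 'I_(j - i) -> bool}|.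
  by rewrite card_ffun card_bool card_ord.
apply: (sep_fin (psi := psi)) => //.
  by rewrite card_ffun card_bool card_ord expn_gt0.
move=> v v' vv'; apply: (lt_le_trans (rad_quarter e j)).
have [a va] : exists a, v a != v' a.
  apply/existsP; rewrite -negb_forall; apply: contra vv' => /forallP vv'.
  by apply/eqP/ffunP => a; apply/eqP; exact: vv'.
apply: le_trans (codeP (psi v) (psi v') (i + a)%N _); last by rewrite !psiE.
by apply: rad_anti; have := ltn_ord a; rewrite ltn_subRL => /ltnW.
Qed.

(** Binary digits. Lebesgue measure on the unit interval is carried to the uniform measure on words,
    the mass distribution for the Hausdorff bound. *)
Definition bits (t : R) (i : nat) : bool := odd (Num.truncn (2 ^+ i.+1 * t)).

Lemma truncn_half (t : R) : 0 <= t -> Num.truncn t = (Num.truncn (2 * t))./2.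
Proof.
move=> t0; have t20 : 0 <= 2 * t by rewrite mulr_ge0.
have /andP[m1 m2] := truncn_itv t20; apply: truncn_def.
set m := Num.truncn _ in m1 m2 *.
have mE : m%:R = (odd m)%:R + 2 * (m./2)%:R :> R.
  by rewrite -{1}[m]odd_double_half natrD -muln2 natrM mulrC.
rewrite -(natr1 m) in m2; rewrite -(natr1 m./2).
have : (odd m)%:R <= 1 :> R by case: (odd m).
have : 0 <= (odd m)%:R :> R by [].
move: mE m1 m2; move: (odd m)%:R m%:R (m./2)%:R; clear => o a b -> *.
by apply/andP; split; lra.
Qed.

Lemma bits_close (t t' : R) j : 0 <= t < 1 -> 0 <= t' < 1 ->
  (forall i, (i < j)%N -> bits t i = bits t' i) -> `|t - t'| <= 2 `^ (- j%:R).
Proof.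
move=> /andP[t0 t1] /andP[t'0 t'1] tt'.
have P0 i : 0 <= 2 ^+ i * t /\ 0 <= 2 ^+ i * t' by split; rewrite mulr_ge0 ?exprn_ge0.
have : forall i, (i <= j)%N -> Num.truncn (2 ^+ i * t) = Num.truncn (2 ^+ i * t').
  elim=> [|i IH] ij.
    rewrite !expr0 !mul1r; have E (x : R) : 0 <= x < 1 -> Num.truncn x = 0%N.
      by move=> x01; apply: truncn_def.
    by rewrite !E ?t0 ?t'0.
  have := IH (ltnW ij); rewrite (truncn_half (P0 i).1) (truncn_half (P0 i).2).
  rewrite !mulrA -!exprS => hE; have := tt' i ij; rewrite /bits => oE.
  by rewrite -[LHS]odd_double_half -[RHS]odd_double_half hE oE.
move=> /(_ j (leqnn j)) jE; have [/truncn_itv + /truncn_itv] := P0 j.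
rewrite jE -(natr1 (Num.truncn (2 ^+ j * t'))); move: (Num.truncn _)%:R => b /andP[b1 b2] /andP[b3 b4].
rewrite powRN powR_mulrn// -[leRHS]mul1r ler_pdivlMr ?exprn_gt0// mulrC.
rewrite -[X in X * _](gtr0_norm (exprn_gt0 j (ltr0Sn R 1))) -normrM mulrBr.
by rewrite ler_norml; apply/andP; split; move: b1 b2 b3 b4; clear; lra.
Qed.

Lemma bits_inj (t t' : R) : 0 <= t < 1 -> 0 <= t' < 1 -> bits t = bits t' -> t = t'.
Proof.
move=> t01 t'01 tt'; apply/eqP; rewrite -subr_eq0 -normr_eq0 eq_le normr_ge0 andbT.
apply/ler_addgt0Pr => eps eps0; rewrite add0r.
have h01 : 0 <= (2^-1 : R) < 1 by rewrite invr_ge0 ler0n invf_lt1 ?ltr1n ?ltr0n.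
have [j jeps] := expr_lt_eps h01 eps0.
apply: le_trans (ltW jeps).
have -> : 2^-1 ^+ j = 2 `^ (- j%:R) :> R by rewrite powRN powR_mulrn// exprVn.
by apply: bits_close => // i _; rewrite tt'.
Qed.

End SpaceBounds.

(** * The space *)

Lemma powR_quarter (R : realType) (s : R) : 4^-1 `^ s = 2 `^ (- (2 * s)).
Proof.
have -> : 4^-1 = 2 `^ (- 2) :> R by rewrite powRN powR_mulrn// -natrX.
by rewrite -powRrM mulNr.
Qed.

Lemma powR2_small (R : realType) (eta : R) : 0 < eta -> exists2 B, 0 <= B & 2 `^ (- B) <= eta.
Proof.
have h01 : 0 <= (2^-1 : R) < 1 by rewrite invr_ge0 ler0n invf_lt1 ?ltr1n ?ltr0n.
move=> /(expr_lt_eps h01)[k /ltW]; rewrite exprVn => kP.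
by exists k%:R; rewrite ?powRN ?powR_mulrn.
Qed.

Section Space.
Context {R : realType} (w : weights R) (e e' : scale R).

(** The [i] leading zeros are negligible among the [gap i] digits, so the comb keeps the box
    dimension of the whole Cantor set. *)
Definition gap j := (j.+1 ^ 2)%N.

Lemma gap_gt j : (j < gap j)%N.
Proof. by rewrite /gap -{1}[j.+1]expn1 leq_pexp2l. Qed.

Lemma gap_mono i j : (i <= j)%N -> (gap i <= gap j)%N.
Proof. by move=> ij; rewrite leq_exp2r. Qed.

Definition full_space := full_cantor e.
Definition comb_space := comb_mspace e' gap.
Definition space := sum_mspace (cube_mspace w) (sum_mspace full_space comb_space).

Local Notation Q := (metric_of (cube_mspace w)).
Local Notation Z := (metric_of full_space).
Local Notation W := (metric_of comb_space).
Local Notation X := (metric_of space).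

Definition inQ (q : Q) : X := inl q.
Definition inZ (z : Z) : X := inr (inl z).
Definition inW (x : W) : X := inr (inr x).

Lemma compact_space : compact [set: X].
Proof.
apply: compact_sum; first exact: compact_cube.
apply: compact_sum; [exact: compact_full_cantor|exact: (@compact_comb _ e' gap gap_gt)].
Qed.

Lemma dim_T_space_le l : (forall i, (l <= i)%N -> wt w i = 0) ->
  (dim_T R X <= l%:R%:E)%E.
Proof.
move=> wl; apply: dim_T_le compact_space _; apply: mesh_sum; first exact: mesh_cube.
by apply: mesh_sum; exact: mesh_cantor.
Qed.

Lemma dim_T_space_ge n : (forall i, (i < n)%N -> 0 < w i) -> (n%:R%:E <= dim_T R X)%E.
Proof.
move=> w0; apply/ereal_infP => _ [k Xk <-]; rewrite lee_fin lerBrDr natr1 ler_nat.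
(* Lipschitz with constant [(w i)^-1] for every [i]: where [w i = 0] both vanish, and across pieces
   the distance is 1. *)
pose p i (x : X) : R := if x is inl q then sval q i / w i else 0.
have w1 i : `|w i * (w i)^-1| <= (w i)^-1.
  rewrite ger0_norm ?mulr_ge0 ?invr_ge0 ?wt_ge0//.
  by rewrite ler_piMl ?invr_ge0 ?wt_ge0// wt_le1.
have q1 (q : Q) i : `|sval q i / w i| <= (w i)^-1.
  apply: le_trans (w1 i); rewrite !normrM ler_wpM2r//.
  by have /andP[q0 qw] := svalP q i; rewrite !ger0_norm ?wt_ge0.
pose q (t : nat -> R) : X := inQ (cube_of w (fun i => t i * w i)).
have qE t i : (forall j, 0 <= t j <= 1) -> clip w (fun i => t i * w i) i = t i * w i.
  move=> t01; have /andP[t0 t1] := t01 i; rewrite clip_id// mulr_ge0 ?wt_ge0//=.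
  by rewrite ler_piMl ?wt_ge0.
apply: (covering_mult_gt (q := q) (p := p) compact_space) Xk => [i|t i ni t01|t t' r r0 t01 t'01 tt'].
- apply: (@continuous_lip _ _ _ (w i)^-1); first by rewrite invr_ge0 wt_ge0.
  move=> [x|x] [y|y]; rewrite mdistE /= ?mulr1 ?sub0r ?subr0 ?normrN ?q1//.
    rewrite -mulrBl normrM mulrC ger0_norm ?invr_ge0 ?wt_ge0//.
    by rewrite ler_wpM2l ?invr_ge0 ?wt_ge0// cube_dist_ge.
  rewrite normr0; apply: mulr_ge0; first by rewrite invr_ge0 wt_ge0.
  exact: (@mspace_dist_ge0 _ (sum_mspace full_space comb_space)).
- by rewrite /p /q /= qE// mulfK// gt_eqF// w0.
- rewrite mdistE /=; apply: cube_dist_le => i /=; rewrite !qE// -mulrBl normrM.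
  apply: le_trans (tt' i); rewrite ler_piMr//.
  by rewrite ger0_norm ?wt_ge0 ?wt_le1.
Qed.

Lemma dim_H_space_ge a : (forall s, 0 <= s -> (s%:E < a)%E ->
  exists c : R, forall j, s * e j <= j%:R + c) -> (a <= dim_H X)%E.
Proof.
move=> eP; apply: hausdorff_dim_ge => s s0 sa; have [c ec] := eP s s0 sa.
(* If the digits first differ at [i], the parameters are within [2^-i], and [s e i <= i + c]
   compares this with the power of the distance. *)
apply: (@hausdorff_measure_neq0 _ _ (fun t => inZ (bits t)) s (2 `^ c)) => //.
move=> t t' t01 t'01; rewrite mdistE /=; case: cdistP => [/bits_inj tt'|i tt' _].
  by rewrite tt'// subrr normr0 mulr_ge0 ?powR_ge0.
apply: le_trans (bits_close t01 t'01 tt') _.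
by rewrite /rad -powRrM -powRD2; apply: ler_powR2; rewrite mulNr mulrC; have := ec i; lraR.
Qed.

(* Baire category: some S i is dense in the cylinder of u at level m. *)
Lemma baire_cantor (S : (set X)^nat) : [set: X] `<=` \bigcup_i S i ->
  exists i m (u : nat -> bool), forall (z : nat -> bool) j, (m <= j)%N ->
    (forall k, (k < m)%N -> z k = u k) ->
    exists2 z' : Z, S i (inZ z') & forall k, (k < j)%N -> z' k = z k.
Proof.
move=> XS; apply: contrapT => nS.
(* Otherwise every cylinder contains a longer one that avoids [S i]; the nested cylinders [G i] then
   close in on a point outside all [S i]. *)
pose P (i : nat) (mu nv : nat * (nat -> bool)) := [/\ (mu.1 < nv.1)%N,
  (forall k, (k < mu.1)%N -> nv.2 k = mu.2 k) &
  forall z' : Z, S i (inZ z') -> ~ forall k, (k < nv.1)%N -> z' k = nv.2 k].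
have /choice[F FP] (imu : nat * (nat * (nat -> bool))) : exists nv, P imu.1 imu.2 nv.
  case: imu => i [m u]; apply: contrapT => nP; apply: nS; exists i, m, u => z j mj zu.
  apply: contrapT => nz; apply: nP; exists (j.+1, z); split => //= z' Sz' zz'.
  by apply: nz; exists z' => // k kj; apply: zz'; exact: ltnW.
pose fix G (i : nat) : nat * (nat -> bool) :=
  if i is i'.+1 then F (i', G i') else (0%N, fun=> false).
have GP i : P i (G i) (G i.+1) by exact: FP (i, G i).
have Gge i : (i <= (G i).1)%N by elim: i => // i IH; have [h _ _] := GP i; exact: leq_ltn_trans h.
have Gagree i d k : (k < (G i).1)%N -> (G (i + d)%N).2 k = (G i).2 k /\ (k < (G (i + d)%N).1)%N.
  move=> ki; elim: d => [|d [IH1 IH2]]; first by rewrite addn0.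
  by rewrite addnS; have [h1 h2 _] := GP (i + d)%N; rewrite h2// (ltn_trans IH2).
pose x : Z := fun k => (G k.+1).2 k.
have xG i k : (k < (G i).1)%N -> x k = (G i).2 k.
  move=> ki; have kk : (k < (G k.+1).1)%N by exact: Gge.
  have [ik|ik] := leqP i k.+1.
    by have [h _] := Gagree i (k.+1 - i)%N k ki; rewrite subnKC in h.
  by have [h _] := Gagree k.+1 (i - k.+1)%N k kk; rewrite subnKC ?(ltnW ik) in h.
have [i _ Sx] := XS (inZ x) Logic.I; have [_ _ /(_ x Sx)] := GP i; apply.
by move=> k; exact: xG.
Qed.

Lemma dim_P_space_ge a : (forall s, 0 <= s -> (s%:E < a)%E ->
  forall M : R, exists j, M <= j%:R - s * e j) -> (a <= dim_P X)%E.
Proof.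
move=> eP; apply: packing_dim_ge => s s0 sa; apply: packing_measure_neq0 => S XS.
have [i [m [u uP]]] := baire_cantor XS; exists i => delta delta0.
have [j0 j0P] := rad_small e delta0.
(* [m] pays for the digits fixed by the cylinder, [2 * s] for the quarter in the radius, and [j0]
   forces [j0 <= j], hence a radius below [delta]. *)
have [j jM] := eP s s0 sa (m%:R + j0%:R + 2 * s).
have se0 : 0 <= s * e j by rewrite mulr_ge0// -(sc0 e) sc_mono.
have [mj j0j] : (m <= j)%N /\ (j0 <= j)%N.
  by split; rewrite -(ler_nat R); have := ler0n R m; have := ler0n R j0; lraR.
pose word (v : {ffun 'I_(j - m) -> bool}) (k : nat) : bool :=
  if (k < m)%N then u k else if insub (k - m)%N is Some a then v a else false.
have /choice[psi psiP] (v : {ffun 'I_(j - m) -> bool}) : exists z : Z,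
    S i (inZ z) /\ forall k, (k < j)%N -> z k = word v k.
  have [|z Sz zE] := uP (word v) j mj; first by move=> k km; rewrite /word km.
  by exists z.
exists (rad e j / 4), (2 ^ (j - m))%N; split.
- rewrite divr_gt0 ?rad_gt0//=; have := rad_anti e j0j; have := rad_gt0 e j; lraR.
- pose code (x : X) : nat -> bool := if x is inr (inl z) then z else fun=> false.
  apply: (sep_words (psi := inZ \o psi) (code := code)).
  + move=> [x|[x|x]] [y|[y|y]] k; rewrite mdistE /= ?eqxx//; try by move=> _; exact: rad_le1.
    exact: cdist_ge.
  + by move=> v; have [] := psiP v.
  + move=> v k; rewrite /code /=; have [_ ->] := psiP v; last by have := ltn_ord k; lia.
    by rewrite /word ltnNge leq_addr /= addKn valK.
- rewrite powRM ?invr_ge0 ?(ltW (rad_gt0 _ _))// /rad -powRrM.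
  rewrite powR_quarter powR2_nat -!powRD2; apply: powR_ge1; first by rewrite ler1n.
  by rewrite natrB//; have := ler0n R j0; lraR.
Qed.

Definition comb0 : W := exist (comb_set gap) (fun=> false) (fun i j xi => ltac:(by [])).

(** Any word supported between [i] and [j] belongs to the comb, because [j <= gap i]: next to the
    zero word the comb contains a full binary tree between these levels. *)
Lemma sep_comb i j : (i <= j <= gap i)%N ->
  sep (cball (inW comb0) (rad e' i)) (rad e' j / 4) (2 ^ (j - i))%N.
Proof.
move=> /andP[ij jg].
pose word (v : {ffun 'I_(j - i) -> bool}) (k : nat) : bool :=
  if (k < i)%N then false else if insub (k - i)%N is Some a then v a else false.
have wordP v k : word v k -> (i <= k < j)%N.
  rewrite /word; case: ltnP => // ik; case: insubP => // a + ak _ /=.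
  by rewrite -(ltn_add2r i) !subnK// => ->.
have word_comb v : comb_set gap (word v).
  move=> k k' /wordP/andP[_ kj] /wordP/andP[ik' _].
  exact: leq_trans kj (leq_trans jg (gap_mono ik')).
pose psi v : W := exist _ (word v) (word_comb v).
pose code (x : X) : nat -> bool := if x is inr (inr x) then sval x else fun=> false.
apply: (sep_words (psi := inW \o psi) (code := code)).
- move=> [x|[x|x]] [y|[y|y]] k; rewrite mdistE /= ?eqxx//; try by move=> _; exact: rad_le1.
  exact: cdist_ge.
- move=> v; rewrite /cball /= mdistE /=; apply: cdist_le => k ki /=.
  by rewrite /word ki.
- move=> v k; rewrite /code /= /word ltnNge leq_addr /= addKn valK//.
Qed.

Lemma dim_uB_space_ge a : (forall s, 0 <= s -> (s%:E < a)%E ->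
  forall M : R, exists i j, (i <= j <= gap i)%N /\ M <= j%:R - i%:R - s * e' j) ->
  (a <= dim_uB X)%E.
Proof.
move=> eP; apply: (dim_uB_ge (inW comb0)) => s d s0 sa d0.
have [j0 j0P] := rad_small e' d0.
have [i [j [ij Mij]]] := eP s s0 sa (j0%:R + 2 * s).
have se0 : 0 <= s * e' j by rewrite mulr_ge0// -(sc0 e') sc_mono.
have j0j : (j0 <= j)%N by rewrite -(ler_nat R); have := ler0n R i; lraR.
have rj := rad_gt0 e' j; have rj1 := rad_le1 e' j.
exists (rad e' j / 4), (2 ^ (j - i))%N; split.
- by rewrite divr_gt0//=; have := rad_anti e' j0j; lraR.
- lraR.
- by have [psi [_ psi2]] := sep_comb ij; exists psi; split.
- rewrite powRM ?invr_ge0 ?(ltW rj)// powR_quarter /rad -powRrM -powRD2 powR2_nat.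
  apply: ler_powR2; rewrite natrB; last by case/andP: ij.
  by have := ler0n R j0; lraR.
Qed.

Lemma dim_A_space_ge a : (forall s, 0 <= s -> (s%:E < a)%E ->
  forall M : R, exists i j, (i <= j <= gap i)%N /\ M <= j%:R - i%:R - s * (e' j - e' i)) ->
  (a <= dim_A X)%E.
Proof.
move=> eP; apply: dim_A_ge => s s0 sa C C0.
(* The logarithm writes [C] as a power of 2, [2 * s] comes from the quarter in the inner radius, and
   1 makes the inequality strict. *)
have [i [j [ij Mij]]] := eP s (ltW s0) sa (ln C / ln 2 + 2 * s + 1).
have ri := rad_gt0 e' i; have rj := rad_gt0 e' j.
have rji : rad e' j <= rad e' i by apply: rad_anti; case/andP: ij.
exists (inW comb0), (rad e' j / 4), (rad e' i), (2 ^ (j - i))%N; split.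
- by apply/andP; split; lraR.
- exact: sep_comb.
- have CE : C = 2 `^ (ln C / ln 2).
    by rewrite /powR pnatr_eq0 /= divfK ?lnK ?posrE// gt_eqF// ln_gt0// ltr1n.
  have -> : rad e' i / (rad e' j / 4) = 2 `^ (e' j - e' i + 2).
    apply: (canLR (mulfK _)); first by rewrite gt_eqF// divr_gt0.
    rewrite powRD2 (_ : 2 `^ 2 = 4 :> R) ?powR_mulrn//; last by rewrite -natrX.
    have -> : rad e' i = 2 `^ (e' j - e' i) * rad e' j.
      by rewrite /rad -powRD2 addrAC subrr add0r.
    by field.
  rewrite {1}CE -powRrM -powRD2 powR2_nat.
  set K := ln C / ln 2 + _.
  apply: (@lt_le_trans _ _ (2 `^ (K + 1))).
    by rewrite (powRD2 K 1) powRr1// ltr_pMr ?powR_gt0// ltr1n.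
  apply: ler_powR2; rewrite natrB; last by case/andP: ij.
  by rewrite /K; lraR.
Qed.

Lemma countable_space : exists c : nat -> X,
  [set: X] `<=` (range inQ `|` range inZ) `|` range c.
Proof.
have [c cW] := countable_comb e' gap_gt; exists (inW \o c) => -[q|[z|x]] _.
- by left; left; exists q.
- by left; right; exists z.
- right; have : range c x by rewrite cW.
  by move=> [n _ <-]; exists n.
Qed.

Lemma box_bound_QZ l s (C : R) : (forall i, (l <= i)%N -> wt w i = 0) -> l%:R <= s ->
  0 <= C -> (forall i j, (i <= j)%N -> j%:R - i%:R <= s * (e j - e i) + C) ->
  exists2 D, 0 <= D & box_bound (range inQ `|` range inZ) s D.
Proof.
move=> wl ls C0 eC; have s0 : 0 <= s by apply: le_trans ls.
have Qb := assouad_box (cube_of w (fun=> 0)) (cube_assouad wl ls).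
have Zb := assouad_box ((fun=> false) : Z) (cantor_assouad (cinj := @inj_id (nat -> bool)) s0 C0 eC).
eexists; last by apply: box_boundU; [exact: box_bound_image Qb|exact: box_bound_image Zb].
by rewrite addr_ge0// !mulr_ge0 ?exprn_ge0 ?powR_ge0.
Qed.

Lemma dim_P_space_le l a : (forall i, (l <= i)%N -> wt w i = 0) -> (l%:R%:E <= a)%E ->
  (forall t, 0 < t -> (a < t%:E)%E -> exists2 C : R, 0 <= C &
    forall i j, (i <= j)%N -> j%:R - i%:R <= t * (e j - e i) + C) ->
  (dim_P X <= a)%E.
Proof.
move=> wl la eP; have a0 : (0 <= a)%E by apply: le_trans la; rewrite lee_fin.
apply: packing_dim_le => // s s0 as_.
(* The geometric series of packing sums needs a counting exponent strictly below [s]. *)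
have [t at_ /andP[t0 ts]] : exists2 t, (a < t%:E)%E & 0 < t < s.
  case: a a0 as_ {la eP} => [a| |] //; rewrite lee_fin !lte_fin => a0 as_.
  by exists ((a + s) / 2); rewrite ?lte_fin; [|apply/andP; split]; lra.
have [C C0 eC] := eP t t0 at_.
have lt_ : l%:R <= t by rewrite -lee_fin (le_trans la)// ltW.
have [D D0 bD] := box_bound_QZ wl lt_ C0 eC.
have [c Xc] := countable_space.
by apply: (packing_measure_eq0 _ D0 Xc bD); rewrite (ltW t0).
Qed.

(** Economical scales for the Cantor set may be sparse, but the cube obeys its bound at every scale,
    so both can be covered at the same one. *)
Lemma dim_H_space_le l a : (forall i, (l <= i)%N -> wt w i = 0) -> (l%:R%:E <= a)%E ->
  (forall s, 0 < s -> (a < s%:E)%E -> forall M : R, exists j, M <= s * e j - j%:R) ->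
  (dim_H X <= a)%E.
Proof.
move=> wl la eP; have a0 : (0 <= a)%E by apply: le_trans la; rewrite lee_fin.
apply: hausdorff_dim_le => // s s0 as_.
have ls : l%:R < s by rewrite -lte_fin (le_lt_trans la).
have [c Xc] := countable_space.
apply: (hausdorff_measure_eq0 s0 Xc) => eps delta eps0 delta0.
have Qb := assouad_box (cube_of w (fun=> 0)) (cube_assouad wl (lexx l%:R)).
set D := _ * _ in Qb; have D0 : 0 < D by rewrite mulr_gt0 ?exprn_gt0 ?powR_gt0.
have eps2 : 0 < eps / 2 by rewrite divr_gt0.
have [B1 B10 B1P] := powR2_small (divr_gt0 eps2 D0).
have [B2 B20 B2P] := powR2_small eps2.
have [j0 j0P] := rad_small e (divr_gt0 delta0 (ltr0Sn R 1)).
have sl : 0 < s - l%:R by rewrite subr_gt0.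
have ej0 : 0 <= e j0 by rewrite -(sc0 e) sc_mono.
(* One large surplus serves three ends: [B2] makes the Cantor part small, [e j >= B1 / (s - l)] the
   cube part, and [e j >= e j0] keeps the radius below [delta]. *)
have [j jM] := eP s s0 as_ (B2 + s * (B1 / (s - l%:R) + e j0)).
have h1 : 0 <= B1 / (s - l%:R) by rewrite divr_ge0// ltW.
have E_ge : B1 / (s - l%:R) + e j0 <= e j.
  by rewrite -(ler_pM2l s0); have := ler0n R j; lraR.
have rjE : rad e j <= rad e j0 by apply: ler_powR2; rewrite lerN2; lraR.
have r0 := rad_gt0 e j.
have [n1 c1 n1D] : exists2 n, pcov [set: Q] (rad e j) n & n%:R <= D * rad e j `^ (- l%:R).
  by apply: Qb; rewrite r0 rad_le1.
have [n2 c2 n2j] := pcov_rad e (@inj_id (nat -> bool)) j.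
exists (rad e j), (n1 + n2)%N; split.
- by rewrite r0 /=; lraR.
- by apply: pcovU; [exact: pcov_image c1|exact: pcov_image c2].
- rewrite natrD mulrDl [eps]splitr; apply: lerD.
    apply: (@le_trans _ _ (D * rad e j `^ (- l%:R) * rad e j `^ s)).
      by rewrite ler_wpM2r ?powR_ge0.
    rewrite -mulrA -ler_pdivlMl// [leRHS]mulrC; apply: le_trans B1P.
    rewrite /rad -!powRrM -powRD2; apply: ler_powR2.
    have : B1 <= e j * (s - l%:R) by rewrite -ler_pdivrMr//; lraR.
    by lraR.
  apply: (@le_trans _ _ (2 `^ j%:R * rad e j `^ s)).
    by rewrite ler_wpM2r ?powR_ge0// -powR2_nat ler_nat.
  apply: le_trans B2P; rewrite /rad -powRrM -powRD2; apply: ler_powR2.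
  have : 0 <= s * (B1 / (s - l%:R) + e j0) by rewrite mulr_ge0 ?addr_ge0// ltW.
  by lraR.
Qed.

Lemma dim_uB_space_le l a : (forall i, (l <= i)%N -> wt w i = 0) -> (l%:R%:E <= a)%E ->
  (forall t, 0 < t -> (a < t%:E)%E -> exists2 C : R, 0 <= C &
    forall i j, (i <= j)%N -> j%:R - i%:R <= t * (e j - e i) + C) ->
  (forall s, 0 < s -> (a < s%:E)%E -> exists2 C : R, 0 <= C &
    forall j, j%:R <= s * e' j + C) ->
  (dim_uB X <= a)%E.
Proof.
move=> wl la eP eP'; have a0 : (0 <= a)%E by apply: le_trans la; rewrite lee_fin.
apply: dim_uB_le => // s as_; have s0 : 0 < s by rewrite -lte_fin (le_lt_trans a0).
have ls : l%:R <= s by rewrite -lee_fin (le_trans la)// ltW.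
have [C C0 eC] := eP s s0 as_; have [C' C'0 eC'] := eP' s s0 as_.
have [D D0 bD] := box_bound_QZ wl ls C0 eC.
have bW : box_bound (range inW) s (2 `^ (C' + 1)).
  by apply: box_bound_image => //; apply: cantor_box => //; exact: ltW.
exists (D + 2 `^ (C' + 1)); first by rewrite ltr_wpDl// powR_gt0.
move=> r /andP[r0 r1]; have [|n c nC] := box_boundU bD bW (r := r).
  by rewrite r0 ltW.
exists n => //; apply: sub_pcov c => -[q|[z|x]] _.
- by left; left; exists q.
- by left; right; exists z.
- by right; exists x.
Qed.

Lemma dim_A_space_le l a : (forall i, (l <= i)%N -> wt w i = 0) -> (l%:R%:E <= a)%E ->
  (forall t, 0 < t -> (a < t%:E)%E -> exists2 C : R, 0 <= C &
    forall i j, (i <= j)%N -> j%:R - i%:R <= t * (e j - e i) + C) ->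
  (forall t, 0 < t -> (a < t%:E)%E -> exists2 C : R, 0 <= C &
    forall i j, (i <= j)%N -> j%:R - i%:R <= t * (e' j - e' i) + C) ->
  (dim_A X <= a)%E.
Proof.
move=> wl la eP eP'; have a0 : (0 <= a)%E by apply: le_trans la; rewrite lee_fin.
apply: dim_A_le => // s as_; have s0 : 0 < s by rewrite -lte_fin (le_lt_trans a0).
have ls : l%:R <= s by rewrite -lee_fin (le_trans la)// ltW.
have [C C0 eC] := eP s s0 as_; have [C' C'0 eC'] := eP' s s0 as_.
exists (3 ^+ l + (2 `^ (C + 1) + 2 `^ (C' + 1))).
  by rewrite !addr_gt0 ?powR_gt0 ?exprn_gt0.
apply: assouad_sum; [exact: (cube_of w (fun=> 0))|exact: (inl (fun=> false))|exact: cube_assouad|].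
by apply: assouad_sum; [exact: (fun=> false)|exact: comb0|exact: cantor_assouad (ltW s0) C0 eC|exact: cantor_assouad (ltW s0) C'0 eC'].
Qed.

End Space.

Lemma weights_fin (R : realType) (l : nat) : exists w : weights R,
  (forall i, (i < l)%N -> 0 < w i) /\ forall i, (l <= i)%N -> wt w i = 0.
Proof.
pose f i : R := if (i < l)%N then 1 else 0.
have f0 i : 0 <= f i by rewrite /f; case: ifP.
have f1 i : f i <= 1 by rewrite /f; case: ifP.
have fcvg (eps : R) : 0 < eps -> exists n, forall i, (n <= i)%N -> f i <= eps.
  by move=> eps0; exists l => i li; rewrite /f ltnNge li ltW.
exists (Weights f0 f1 fcvg); split => i il /=; first by rewrite /f il.
by rewrite /f ltnNge il.
Qed.

Lemma weights_pos (R : realType) : exists w : weights R, forall i, 0 < w i.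
Proof.
pose f i : R := i.+1%:R^-1.
have f0 i : 0 < f i by rewrite invr_gt0 ltr0n.
have f1 i : f i <= 1 by rewrite invf_le1 ?ltr0n// ler1n.
have fcvg (eps : R) : 0 < eps -> exists n, forall i, (n <= i)%N -> f i <= eps.
  move=> eps0; have [n _ nP] := near_infty_natSinv_lt (PosNum eps0).
  by exists n => i /nP /ltW.
by exists (Weights (fun i => ltW (f0 i)) f1 fcvg).
Qed.

Local Open Scope ereal_scope.

Theorem theorem1p2 (R : realType) (l a1 a2 a3 a4 : \bar R)
    (hl : l = +oo \/ exists n : nat, l = n%:R%:E)
    (ha : [/\ 0 <= a1, 0 <= a2, 0 <= a3 & 0 <= a4])
    (hla : [/\ l <= a1, a1 <= a2, a2 <= a3 & a3 <= a4]) :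
  exists X : metricType R, compact [set: X] /\
    [/\ dim_T R X = l, dim_H X = a1, dim_P X = a2, dim_uB X = a3
      & dim_A X = a4].
Proof.
case: ha => a10 a20 a30 a40; case: hla => la1 a12 a23 a34.
have [e [eH eP eH' eP']] := scale_full a10 a12.
have [e' [eB eB' eA eA']] := scale_comb a30 a34.
case: hl => [ly|[n ln]]; subst l.
  have [w w0] := weights_pos R; exists (metric_of (space w e e')).
  (* All five values are infinite here, so lower bounds suffice. *)
  have a1y : a1 = +oo by apply/eqP; rewrite -leye_eq.
  have a2y : a2 = +oo by apply/eqP; rewrite -leye_eq -a1y.
  have a3y : a3 = +oo by apply/eqP; rewrite -leye_eq -a2y.
  have a4y : a4 = +oo by apply/eqP; rewrite -leye_eq -a3y.
  subst a1 a2 a3 a4; split; first exact: compact_space.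
  split; apply/eqP; rewrite -leye_eq.
  - apply: lee_real_lt => s _; have [n _ sn] := natr_ge s.
    apply: le_trans (_ : n%:R%:E <= _); first by rewrite lee_fin.
    by apply: dim_T_space_ge => i _.
  - exact: dim_H_space_ge.
  - exact: dim_P_space_ge.
  - exact: dim_uB_space_ge.
  - exact: dim_A_space_ge.
have [w [w0 wn]] := weights_fin R n; exists (metric_of (space w e e')).
have la2 := le_trans la1 a12; have la3 := le_trans la2 a23.
have la4 := le_trans la3 a34.
(* The increments of [e] are controlled for exponents above [a2], hence above [a3] and [a4]: the
   full Cantor set does not raise the last two dimensions. *)
have eP3 t : (0 < t)%R -> a3 < t%:E -> _ := fun t0 h => eP' t t0 (le_lt_trans a23 h).
have eP4 t : (0 < t)%R -> a4 < t%:E -> _ := fun t0 h => eP3 t t0 (le_lt_trans a34 h).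
split; first exact: compact_space.
split; apply/eqP; rewrite eq_le; apply/andP; split.
- exact: (dim_T_space_le _ _ wn).
- exact: dim_T_space_ge.
- exact: (dim_H_space_le _ wn la1 eH').
- exact: dim_H_space_ge.
- exact: (dim_P_space_le _ wn la2 eP').
- exact: dim_P_space_ge.
- exact: (dim_uB_space_le wn la3 eP3 eB).
- exact: dim_uB_space_ge.
- exact: (dim_A_space_le wn la4 eP4 eA').
- exact: dim_A_space_ge.
Qed.
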